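(* Let $\kappa$ be an algebraically closed field of characteristic zero, complete for a non-trivial non-Archimedean absolute value. Fix a positive integer $n$ and $\alpha_i,\beta_i\in\kappa$ ($i=0,\dots,n$) with $|\alpha_i|=1$, $\alpha_0=1$, $\beta_0=0$, such that the maps $L_i(z)=\alpha_iz+\beta_i$ are pairwise distinct. Let $\Omega(X_0,\dots,X_n)=\sum_{i\in I}c_iX_0^{i_0}\cdots X_n^{i_n}$ be a non-zero polynomial with coefficients $c_i\in\mathcal{M}(\kappa)$. Let $f\in\mathcal{M}(\kappa)$ be non-constant, put $f_i=f\circ L_i$, and suppose $$\Omega(f,f_1,\dots,f_n)=0$$ with $f$ admissible, i.e. $\sum_{i\in I}T(r,c_i)=o(T(r,f))$ as $r\to\infty$. If $a\in\mathcal{M}(\kappa)$ satisfies $T(r,a)=o(T(r,f))$ and $\Omega(a,a\circ L_1,\dots,a\circ L_n)\not\equiv0$, then $$m\!\left(r,\frac1{f-a}\right)=o(T(r,f))\quad(r\to\infty).$$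
   Context: $\mathcal{M}(\kappa)$ is the field of meromorphic functions over $\kappa$ (quotients of power series converging on all of $\kappa$). For entire $g=\sum a_nz^n$, $\mu(r,g)=\max_n|a_n|r^n$, and for $f=g/h$, $\mu(r,f)=\mu(r,g)/\mu(r,h)$; $m(r,f)=\log^+\mu(r,f)$; $N(r,f)=\int_0^r\frac{n(t,f)-n(0,f)}{t}dt+n(0,f)\log r$ where $n(t,f)$ counts poles in $|z|\le t$ with multiplicity; $T(r,f)=m(r,f)+N(r,f)$. *)

(* Defs.v *)
From HB Require Import structures.
From mathcomp Require Import all_boot all_order all_algebra.
From mathcomp Require Import all_classical all_reals all_analysis.
Set Implicit Arguments. Unset Strict Implicit. Unset Printing Implicit Defensive.
Import Order.TTheory GRing.Theory Num.Theory.
Local Open Scope ring_scope.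
Local Open Scope classical_set_scope.

Definition is_na_abs (R : realType) (K : fieldType) (abs : K -> R) : Prop :=
  (forall x : K, 0 <= abs x) /\
  (forall x : K, abs x = 0 <-> x = 0) /\
  (forall x y : K, abs (x * y) = abs x * abs y) /\
  (forall x y : K, abs (x + y) <= Num.max (abs x) (abs y)).

Definition abs_nontrivial (R : realType) (K : fieldType) (abs : K -> R) : Prop :=
  exists x : K, abs x != 0 /\ abs x != 1.

Definition abs_complete (R : realType) (K : fieldType) (abs : K -> R) : Prop :=
  forall u : nat -> K,
    (forall e : R, 0 < e -> exists N : nat, forall m k : nat,
        (N <= m)%N -> (N <= k)%N -> abs (u m - u k) < e) ->
    exists l : K, forall e : R, 0 < e -> exists N : nat, forall m : nat,
        (N <= m)%N -> abs (u m - l) < e.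

(* Entire functions: coefficient sequences of power series converging *)
(* on all of kappa.                                                   *)

Definition is_entire (R : realType) (K : fieldType) (abs : K -> R)
    (a : nat -> K) : Prop :=
  forall r : R, 0 < r -> forall e : R, 0 < e ->
    exists N : nat, forall n : nat, (N <= n)%N -> abs (a n) * r ^+ n < e.

Definition series_to (R : realType) (K : fieldType) (abs : K -> R)
    (a : nat -> K) (z v : K) : Prop :=
  forall e : R, 0 < e -> exists N : nat, forall m : nat,
    (N <= m)%N -> abs (\sum_(i < m) a i * z ^+ i - v) < e.

Definition ent_eval (R : realType) (K : closedFieldType) (abs : K -> R)
    (a : nat -> K) (z : K) : K :=
  xget 0 (series_to abs a z).

Definition taylor_coef (R : realType) (K : closedFieldType) (abs : K -> R)
    (a : nat -> K) (z : K) (k : nat) : K :=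
  ent_eval abs (fun n => a (n + k)%N * ('C(n + k, k))%:R) z.

(* order of vanishing at z (meaningful when a is not identically 0) *)
Definition ent_ord (R : realType) (K : closedFieldType) (abs : K -> R)
    (a : nat -> K) (z : K) : nat :=
  xget 0%N (fun k => taylor_coef abs a z k != 0 /\
                     forall j : nat, (j < k)%N -> taylor_coef abs a z j = 0).

Definition ps_mul (K : fieldType) (a b : nat -> K) : nat -> K :=
  fun n => \sum_(i < n.+1) a i * b (n - i)%N.

Definition mu_ent (R : realType) (K : fieldType) (abs : K -> R)
    (a : nat -> K) (r : R) : R :=
  sup (range (fun n : nat => abs (a n) * r ^+ n)).

Record mero (K : Type) := Mero { num : nat -> K ; den : nat -> K }.

Definition is_mero (R : realType) (K : fieldType) (abs : K -> R)
    (f : mero K) : Prop :=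
  is_entire abs (num f) /\ is_entire abs (den f) /\ exists n, den f n != 0.

Definition mero_nonzero (K : fieldType) (f : mero K) : Prop :=
  exists n, num f n != 0.

Definition mero_sub (K : fieldType) (f a : mero K) : mero K :=
  Mero (fun n => ps_mul (num f) (den a) n - ps_mul (num a) (den f) n)
       (ps_mul (den f) (den a)).

Definition mero_inv (K : fieldType) (f : mero K) : mero K :=
  Mero (den f) (num f).

(* f is defined (finite, via this representation) at z *)
Definition mero_def (R : realType) (K : closedFieldType) (abs : K -> R)
    (f : mero K) (z : K) : Prop :=
  ent_eval abs (den f) z != 0.

Definition mero_eval (R : realType) (K : closedFieldType) (abs : K -> R)
    (f : mero K) (z : K) : K :=
  ent_eval abs (num f) z / ent_eval abs (den f) z.

Definition mero_nonconst (R : realType) (K : closedFieldType) (abs : K -> R)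
    (f : mero K) : Prop :=
  exists z w : K, mero_def abs f z /\ mero_def abs f w /\
                  mero_eval abs f z != mero_eval abs f w.

(* multiplicity of z as a pole of f (0 if z is not a pole) *)
Definition pole_mult (R : realType) (K : closedFieldType) (abs : K -> R)
    (f : mero K) (z : K) : nat :=
  if `[< exists k, taylor_coef abs (num f) z k != 0 >]
  then (ent_ord abs (den f) z - ent_ord abs (num f) z)%N
  else 0%N.

Definition npoles (R : realType) (K : closedFieldType) (abs : K -> R)
    (f : mero K) (t : R) : R :=
  (\sum_(z \in [set z : K | abs z <= t]) pole_mult abs f z)%:R.

Definition Ncount (R : realType) (K : closedFieldType) (abs : K -> R)
    (f : mero K) (r : R) : R :=
  Rintegral (@lebesgue_measure R) `]0, r]
    (fun t => (npoles abs f t - npoles abs f 0) / t)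
  + npoles abs f 0 * ln r.

Definition mu_mero (R : realType) (K : fieldType) (abs : K -> R)
    (f : mero K) (r : R) : R :=
  mu_ent abs (num f) r / mu_ent abs (den f) r.

Definition mprox (R : realType) (K : closedFieldType) (abs : K -> R)
    (f : mero K) (r : R) : R :=
  Num.max 0 (ln (mu_mero abs f r)).

Definition Tchar (R : realType) (K : closedFieldType) (abs : K -> R)
    (f : mero K) (r : R) : R :=
  mprox abs f r + Ncount abs f r.

Definition little_o_inf (R : realType) (u v : R -> R) : Prop :=
  forall e : R, 0 < e -> exists r0 : R, forall r : R, r0 < r ->
    `|u r| <= e * `|v r|.

Definition Omega_dom (R : realType) (K : closedFieldType) (abs : K -> R)
    (n : nat) (I : seq ((n.+1).-tuple nat)) (c : (n.+1).-tuple nat -> mero K)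
    (al be : 'I_n.+1 -> K) (F : mero K) (z : K) : Prop :=
  (forall i, i \in I -> mero_def abs (c i) z) /\
  (forall j : 'I_n.+1, mero_def abs F (al j * z + be j)).

Definition Omega_at (R : realType) (K : closedFieldType) (abs : K -> R)
    (n : nat) (I : seq ((n.+1).-tuple nat)) (c : (n.+1).-tuple nat -> mero K)
    (al be : 'I_n.+1 -> K) (F : mero K) (z : K) : K :=
  \sum_(i <- I) (mero_eval abs (c i) z *
     \prod_(j < n.+1) (mero_eval abs F (al j * z + be j)) ^+ (tnth i j)).

(* Main.v *)
Require Import Defs.
From HB Require Import structures.
From mathcomp Require Import all_boot all_order all_algebra.
From mathcomp Require Import all_classical all_reals all_analysis.
From mathcomp Require Import ring lra zify.
Set Implicit Arguments. Unset Strict Implicit. Unset Printing Implicit Defensive.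
Import Order.TTheory GRing.Theory Num.Theory.
Local Open Scope ring_scope.

(** The Gauss norms [F |-> mu(r, F)] are multiplicative on entire functions and,
    for [r >= |beta|], invariant under [z |-> alpha z + beta] with [|alpha| = 1].
    Write a = u/v and f = g/h, clear the denominators of the coefficients, and let
    P be the resulting entire function for [Omega(a, ...)].  Subtracting the equation
    satisfied by f from it, every monomial contributes a factor [g v - u h], hence
    [1 / mu(r, f - a)] is at most a product of powers of the norms of u, v and of the
    numerators and denominators of the [c_i], divided by [mu(r, P)].  At a given r
    one may first cancel the common zeros in [|z| <= r]; the zeros left in a
    denominator are then the poles counted by N(r, .), so that its growth from a
    fixed [r0] to r is at most [N(r, .)] (Jensen), while [mu(r, P) >= mu(r0, P)].
    Cancellation does not change the quotients of norms at [r0], so that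
    [m(r, 1/(f-a)) <= sum_i T(r, c_i) + N T(r, a) + O(1)]. *)

(** Only true poles enter N(r, .), but a quotient is given with arbitrary common zeros. These are
    cancelled disc by disc, so the reduced functions depend on r, while the O(1) must not. What
    rescues uniformity is homogeneity of the cleared equation: a common factor of u and v, or of the
    numerator and denominator of a coefficient, leaves P with exactly the power it has in the norms
    that bound 1/mu(r, f-a). The constant can thus be formed from the original data at r0. The pair
    g, h stays as given: only mu(r, h) mu(r, v) / mu(r, gv - uh) is estimated, and a common factor
    of g and h drops out of it.

    Jensen requires a theory of zeros in discs. It rests on the largest index attaining mu(r, .): a
    linear factor with root in the disc raises this index by one, and a series of index 0 has no
    zero there. Completeness supplies the zeros.

    The O(1) is absorbed at the end because a non-constant f satisfies T(r, f) >= log r + O(1). *)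

Section AbsoluteValue.
Variables (R : realType) (K : fieldType) (abs : K -> R).
Hypothesis absP : is_na_abs abs.

Lemma abs_ge0 x : 0 <= abs x.
Proof. by have [h _] := absP. Qed.

Lemma abs_eq0 x : (abs x == 0) = (x == 0).
Proof. by have [_ [h _]] := absP; apply/eqP/eqP => /h. Qed.

Lemma abs0 : abs 0 = 0.
Proof. by apply/eqP; rewrite abs_eq0. Qed.

Lemma abs_gt0 x : (0 < abs x) = (x != 0).
Proof. by rewrite lt_def abs_ge0 abs_eq0 andbT. Qed.

Lemma absM x y : abs (x * y) = abs x * abs y.
Proof. by have [_ [_ [h _]]] := absP. Qed.

Lemma absD x y : abs (x + y) <= Num.max (abs x) (abs y).
Proof. by have [_ [_ [_ h]]] := absP. Qed.

Lemma abs1 : abs 1 = 1.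
Proof.
have h : abs 1 != 0 by rewrite abs_eq0 oner_eq0.
by apply: (mulfI h); rewrite -absM !mulr1.
Qed.

Lemma absN x : abs (- x) = abs x.
Proof.
rewrite -mulN1r absM; suff -> : abs (-1) = 1 by rewrite mul1r.
apply/eqP; rewrite -sqrp_eq1 ?abs_ge0// expr2 -absM mulrNN mulr1 abs1//.
Qed.

Lemma absB x y : abs (x - y) <= Num.max (abs x) (abs y).
Proof. by rewrite -(absN y); exact: absD. Qed.

Lemma abs_distC x y : abs (x - y) = abs (y - x).
Proof. by rewrite -absN opprB. Qed.

Lemma absD_le x y M : abs x <= M -> abs y <= M -> abs (x + y) <= M.
Proof. by move=> hx hy; apply: le_trans (absD _ _) _; rewrite ge_max hx hy. Qed.

Lemma absB_le x y M : abs x <= M -> abs y <= M -> abs (x - y) <= M.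
Proof. by move=> hx hy; apply: absD_le => //; rewrite absN. Qed.

Lemma absB_lt x y M : abs x < M -> abs y < M -> abs (x - y) < M.
Proof. by move=> hx hy; apply: le_lt_trans (absB _ _) _; rewrite gt_max hx hy. Qed.

Lemma absV x : abs x^-1 = (abs x)^-1.
Proof.
have [->|x0] := eqVneq x 0; first by rewrite invr0 abs0 invr0.
have h : abs x != 0 by rewrite abs_eq0.
by apply: (mulfI h); rewrite -absM !divff ?abs1.
Qed.

Lemma absX x n : abs (x ^+ n) = abs x ^+ n.
Proof. by elim: n => [|n IH]; rewrite ?expr0 ?abs1// !exprS absM IH. Qed.

Lemma abs_prod (I : Type) (s : seq I) (F : I -> K) :
  abs (\prod_(i <- s) F i) = \prod_(i <- s) abs (F i).
Proof. by elim: s => [|i s IH]; rewrite ?big_nil ?abs1// !big_cons absM IH. Qed.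

Lemma abs_sum_le (I : eqType) (s : seq I) (P : pred I) (F : I -> K) (M : R) :
  0 <= M -> (forall i, i \in s -> P i -> abs (F i) <= M) ->
  abs (\sum_(i <- s | P i) F i) <= M.
Proof.
move=> M0 h; rewrite big_seq_cond; apply: (big_ind (fun x => abs x <= M)).
- by rewrite abs0.
- by move=> x y; exact: absD_le.
- by move=> i /andP[]; exact: h.
Qed.

Lemma abs_sum_lt (I : eqType) (s : seq I) (P : pred I) (F : I -> K) (M : R) :
  0 < M -> (forall i, i \in s -> P i -> abs (F i) < M) ->
  abs (\sum_(i <- s | P i) F i) < M.
Proof.
move=> M0 h; rewrite big_seq_cond; apply: (big_ind (fun x => abs x < M)).
- by rewrite abs0.
- by move=> x y hx hy; apply: le_lt_trans (absD _ _) _; rewrite gt_max hx hy.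
- by move=> i /andP[]; exact: h.
Qed.

Lemma abs_nat n : abs n%:R <= 1.
Proof.
elim: n => [|n IH]; first by rewrite abs0.
by rewrite -addn1 natrD; apply: absD_le; rewrite ?abs1.
Qed.

Lemma absD_eq x y : abs y < abs x -> abs (x + y) = abs x.
Proof.
move=> h; apply/eqP; rewrite eq_le absD_le ?(ltW h)//=.
have := absB (x + y) y; rewrite addrK le_max => /orP[//|h'].
by move: (lt_le_trans h h'); rewrite ltxx.
Qed.

Lemma abs_dist_max x y z : abs (x - z) <= Num.max (abs (x - y)) (abs (y - z)).
Proof. by have := absD (x - y) (y - z); rewrite addrA subrK. Qed.

End AbsoluteValue.

(** * Gauss norms of power series *)

Section GaussNorm.
Variables (R : realType) (K : fieldType) (abs : K -> R).
Hypothesis absP : is_na_abs abs.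
Local Notation ent := (is_entire abs).
Local Notation mu := (mu_ent abs).
Implicit Types (a b : nat -> K) (r : R).

Lemma entire_bounded a r : ent a -> 0 < r ->
  exists2 M, 0 < M & forall n, abs (a n) * r ^+ n <= M.
Proof.
move=> ea r0; have [N hN] := ea _ r0 1 ltr01.
exists (1 + \sum_(i < N) abs (a i) * r ^+ i).
  by rewrite ltr_wpDr//; apply: sumr_ge0 => i _; rewrite mulr_ge0 ?(abs_ge0 absP)// exprn_ge0// ltW.
have ge0 i : 0 <= abs (a i) * r ^+ i by rewrite mulr_ge0 ?(abs_ge0 absP)// exprn_ge0// ltW.
move=> n; have [nN|Nn] := ltnP n N.
  rewrite (bigD1 (Ordinal nN))//= addrCA lerDl addr_ge0//.
  by apply: sumr_ge0 => i _; exact: ge0.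
apply: (le_trans (ltW (hN n Nn))); rewrite lerDl.
by apply: sumr_ge0 => i _; exact: ge0.
Qed.

Lemma mu_le a r M : (forall n, abs (a n) * r ^+ n <= M) -> mu a r <= M.
Proof.
move=> h; apply: ge_sup; first by exists (abs (a 0%N) * r ^+ 0); exists 0%N.
by move=> _ [n _ <-].
Qed.

Lemma mu_ub a r n : ent a -> 0 < r -> abs (a n) * r ^+ n <= mu a r.
Proof.
move=> ea r0; have [M _ hM] := entire_bounded ea r0.
apply: ub_le_sup; last by exists n.
by exists M => _ [k _ <-].
Qed.

Lemma mu_ge0 a r : ent a -> 0 < r -> 0 <= mu a r.
Proof.
move=> ea r0; apply: le_trans (mu_ub 0 ea r0).
by rewrite expr0 mulr1 (abs_ge0 absP).
Qed.

(** The Weierstrass degree at radius [r]. It is the number of zeros in [|z| <= r] with multiplicity;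
    taking the last maximal index, not the first, is what makes the disc closed. *)
Definition maxidx a r k := forall n,
  abs (a n) * r ^+ n <= abs (a k) * r ^+ k /\
  ((k < n)%N -> abs (a n) * r ^+ n < abs (a k) * r ^+ k).

Lemma maxidx_gt0 a r k : 0 < r -> maxidx a r k -> 0 < abs (a k) * r ^+ k.
Proof.
move=> r0 /(_ k.+1)[_ /(_ (ltnSn _))]; apply: le_lt_trans.
by rewrite mulr_ge0 ?(abs_ge0 absP)// exprn_ge0// ltW.
Qed.

Lemma maxidx_neq0 a r k : 0 < r -> maxidx a r k -> a k != 0.
Proof.
move=> r0 /(maxidx_gt0 r0); apply: contraTneq => ->.
by rewrite (abs0 absP) mul0r ltxx.
Qed.

Lemma maxidx_mu a r k : maxidx a r k -> mu a r = abs (a k) * r ^+ k.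
Proof.
move=> h; apply/eqP; rewrite eq_le mu_le/=; last by move=> n; have [] := h n.
apply: ub_le_sup; last by exists k.
by exists (abs (a k) * r ^+ k) => _ [n _ <-]; have [] := h n.
Qed.

Lemma maxidx_exists a r n0 : ent a -> 0 < r -> a n0 != 0 ->
  exists k, maxidx a r k.
Proof.
move=> ea r0 an0; pose F n := abs (a n) * r ^+ n.
have F0 : 0 < F n0 by rewrite /F mulr_gt0 ?exprn_gt0// (abs_gt0 absP).
(* From [N] on, every term lies below the non-zero term at [n0], so all places where the maximum is
   attained are among finitely many indices. *)
have [N hN] := ea _ r0 _ F0.
have n0N : (n0 < N)%N by rewrite ltnNge; apply/negP => /hN; rewrite ltxx.
pose i0 := Ordinal n0N.
pose P k := `[< forall n, F n <= F k >].
have exP : exists k, P k.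
  have [i _ hi] := @Order.TotalTheory.arg_maxP _ _ _ i0 predT (fun i : 'I_N => F i) isT.
  exists i; apply/asboolP => n; have [nN|Nn] := ltnP n N.
    exact: (hi (Ordinal nN)).
  by apply: le_trans (ltW (hN n Nn)) _; exact: (hi i0).
have ubP k : P k -> (k <= N)%N.
  move=> /asboolP /(_ n0) h; rewrite leqNgt; apply/negP => Nk.
  by have := hN k (ltnW Nk); rewrite ltNge h.
case: (ex_maxnP exP ubP) => k /asboolP hk hmax; exists k => n; split; first exact: hk.
move=> kn; rewrite lt_neqAle hk andbT; apply: contraTneq kn => e.
by rewrite -leqNgt; apply: hmax; apply/asboolP => m; rewrite /F e; exact: hk.
Qed.

Lemma mulr_lt_le (x y x' y' : R) :
  0 <= x -> 0 <= y -> 0 < x' -> 0 < y' -> x <= x' -> y <= y' ->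
  (x < x') || (y < y') -> x * y < x' * y'.
Proof.
move=> x0 y0 x'0 y'0 xx yy /orP[h|h].
  by apply: (@le_lt_trans _ _ (x * y')); rewrite ?ler_wpM2l// ltr_pM2r.
by apply: (@le_lt_trans _ _ (x' * y)); rewrite ?ler_wpM2r// ltr_pM2l.
Qed.

(** Gauss's lemma. In the coefficient of index [i + j] every pair other than [(i, j)] exceeds [i] on
    the left or [j] on the right, hence is strictly smaller; a single dominant term determines the
    absolute value of the sum. *)
Lemma maxidx_mul_mu a b r i j : 0 < r -> maxidx a r i -> maxidx b r j ->
  maxidx (ps_mul a b) r (i + j) /\ mu (ps_mul a b) r = mu a r * mu b r.
Proof.
move=> r0 ha hb; pose A n := abs (a n) * r ^+ n; pose B n := abs (b n) * r ^+ n.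
have A0 n : 0 <= A n by rewrite mulr_ge0 ?(abs_ge0 absP)// exprn_ge0// ltW.
have B0 n : 0 <= B n by rewrite mulr_ge0 ?(abs_ge0 absP)// exprn_ge0// ltW.
have Ai := maxidx_gt0 r0 ha; have Bj := maxidx_gt0 r0 hb.
have M0 : 0 < A i * B j by exact: mulr_gt0.
have rn n : 0 < r ^+ n by exact: exprn_gt0.
have termE n (l : 'I_n.+1) : abs (a l * b (n - l)%N) * r ^+ n = A l * B (n - l)%N.
  rewrite (absM absP) /A /B mulrACA -exprD subnKC// -ltnS; exact: ltn_ord.
have term_le n (l : 'I_n.+1) : abs (a l * b (n - l)%N) <= A i * B j / r ^+ n.
  rewrite ler_pdivlMr// termE ler_pM//; first by have [] := ha l.
  by have [] := hb (n - l)%N.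
have term_lt n (l : 'I_n.+1) : (i < l)%N || (j < n - l)%N ->
    abs (a l * b (n - l)%N) < A i * B j / r ^+ n.
  move=> h; rewrite ltr_pdivlMr// termE mulr_lt_le//.
  - by have [] := ha l.
  - by have [] := hb (n - l)%N.
  by case/orP: h => h; apply/orP; [left|right]; [have [_] := ha l|have [_] := hb (n - l)%N]; apply.
have eqM : abs (ps_mul a b (i + j)%N) * r ^+ (i + j) = A i * B j.
  have ij : (i < (i + j).+1)%N by rewrite ltnS leq_addr.
  rewrite /ps_mul (bigD1 (Ordinal ij))//= addKn.
  have e : abs (a i * b j) = A i * B j / r ^+ (i + j).
    by have := termE _ (Ordinal ij); rewrite /= addKn => <-; rewrite mulfK// gt_eqF.
  rewrite (absD_eq absP) ?e ?divfK ?gt_eqF//.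
  apply: (abs_sum_lt absP) => [|l _ li]; first by rewrite divr_gt0.
  apply: term_lt; rewrite -val_eqE/= in li; have := ltn_ord l; lia.
suff h : maxidx (ps_mul a b) r (i + j).
  by split=> //; rewrite (maxidx_mu h) (maxidx_mu ha) (maxidx_mu hb).
move=> n; rewrite eqM; split.
  rewrite -ler_pdivlMr//; apply: (abs_sum_le absP) => [|l _ _]; last exact: term_le.
  by rewrite divr_ge0// ltW.
move=> n_gt; rewrite -ltr_pdivlMr//; apply: (abs_sum_lt absP) => [|l _ _].
  by rewrite divr_gt0.
apply: term_lt; have := ltn_ord l; lia.
Qed.

Lemma entire_mul a b : ent a -> ent b -> ent (ps_mul a b).
Proof.
move=> ea eb r r0 e e0.
have [A A0 hA] := entire_bounded ea r0; have [B B0 hB] := entire_bounded eb r0.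
have [N1 h1] := ea r r0 (e / B) (divr_gt0 e0 B0).
have [N2 h2] := eb r r0 (e / A) (divr_gt0 e0 A0).
exists (N1 + N2)%N => n hn.
have rn : 0 < r ^+ n by exact: exprn_gt0.
rewrite -ltr_pdivlMr//; apply: (abs_sum_lt absP) => [|l _ _]; first by rewrite divr_gt0.
rewrite ltr_pdivlMr//.
have -> : abs (a l * b (n - l)%N) * r ^+ n =
    (abs (a l) * r ^+ l) * (abs (b (n - l)%N) * r ^+ (n - l)).
  rewrite (absM absP) mulrACA -exprD subnKC// -ltnS; exact: ltn_ord.
have ge0 (c : nat -> K) m : 0 <= abs (c m) * r ^+ m.
  by rewrite mulr_ge0 ?(abs_ge0 absP)// exprn_ge0// ltW.
have [l1|l1] := leqP N1 l.
  apply: le_lt_trans (_ : _ <= abs (a l) * r ^+ l * B) _; first by rewrite ler_wpM2l.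
  by rewrite -ltr_pdivlMr// h1.
apply: le_lt_trans (_ : _ <= A * (abs (b (n - l)%N) * r ^+ (n - l))) _.
  by rewrite ler_wpM2r.
by rewrite mulrC -ltr_pdivlMr// h2//; have := ltn_ord l; lia.
Qed.

Lemma entire_finite a N : (forall n, (N <= n)%N -> a n = 0) -> ent a.
Proof.
by move=> h r r0 e e0; exists N => n /h ->; rewrite (abs0 absP) mul0r.
Qed.

Lemma entire_sub a b : ent a -> ent b -> ent (fun n => a n - b n).
Proof.
move=> ea eb r r0 e e0; have [N1 h1] := ea r r0 e e0; have [N2 h2] := eb r r0 e e0.
exists (N1 + N2)%N => n hn; have rn : 0 < r ^+ n by exact: exprn_gt0.
rewrite -ltr_pdivlMr//; apply: (absB_lt absP); rewrite ltr_pdivlMr//.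
  by apply: h1; lia.
by apply: h2; lia.
Qed.

Lemma entire0 : ent (fun=> 0).
Proof. exact: (@entire_finite _ 0%N). Qed.

Lemma entire_poly (p : {poly K}) : ent (fun n => p`_n).
Proof. by apply: (@entire_finite _ (size p)) => n; exact: nth_default. Qed.

Lemma mu0 r : mu (fun=> 0) r = 0.
Proof.
rewrite /mu_ent; have -> : range (fun n : nat => abs 0 * r ^+ n) = [set 0]%classic.
  rewrite (abs0 absP); apply/seteqP; split => [_ [n _ <-]|_ ->] /=; first by rewrite mul0r.
  by exists 0%N => //; rewrite mul0r.
exact: sup1.
Qed.

Lemma mu_eq0 a r : ent a -> 0 < r -> mu a r = 0 -> a = fun=> 0.
Proof.
move=> ea r0 h; apply/funext => n; apply/eqP; rewrite -(abs_eq0 absP).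
have := mu_ub n ea r0; rewrite h pmulr_lle0 ?exprn_gt0// => h'.
by rewrite eq_le h' (abs_ge0 absP).
Qed.

Lemma ps_mul0l b : ps_mul (fun=> 0) b = fun=> 0.
Proof. by apply/funext => n; rewrite /ps_mul big1// => i _; rewrite mul0r. Qed.

Lemma ps_mul0r a : ps_mul a (fun=> 0) = fun=> 0.
Proof. by apply/funext => n; rewrite /ps_mul big1// => i _; rewrite mulr0. Qed.

Lemma seq_eq0P a : a = (fun=> 0) \/ exists n, a n != 0.
Proof.
have [h|h] := pselect (exists n, a n != 0); [by right|left].
by apply/funext => n; apply: contrapT => an; apply: h; exists n; apply/eqP.
Qed.

Lemma mu_mul a b r : ent a -> ent b -> 0 < r -> mu (ps_mul a b) r = mu a r * mu b r.
Proof.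
move=> ea eb r0.
have [->|[n an]] := seq_eq0P a; first by rewrite ps_mul0l mu0 mul0r.
have [->|[m bm]] := seq_eq0P b; first by rewrite ps_mul0r mu0 mulr0.
have [i hi] := maxidx_exists ea r0 an; have [j hj] := maxidx_exists eb r0 bm.
by have [] := maxidx_mul_mu r0 hi hj.
Qed.

End GaussNorm.

(** * Evaluation and division of entire series *)

Section Evaluation.
Variables (R : realType) (K : closedFieldType) (abs : K -> R).
Hypothesis absP : is_na_abs abs.
Hypothesis absC : abs_complete abs.
Local Notation ent := (is_entire abs).
Local Notation mu := (mu_ent abs).
Local Notation ev := (ent_eval abs).
Local Notation cf p := (fun n => (p : {poly K})`_n).
Implicit Types (a b : nat -> K) (r : R) (p q : {poly K}) (z w : K).

Lemma mu_sub a b r : ent a -> ent b -> 0 < r ->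
  mu (fun n => a n - b n) r <= Num.max (mu a r) (mu b r).
Proof.
move=> ea eb r0; apply: mu_le => n; have rn : 0 < r ^+ n by exact: exprn_gt0.
rewrite -ler_pdivlMr//; apply: (absB_le absP); rewrite ler_pdivlMr// le_max (mu_ub absP)//.
by rewrite orbT.
Qed.

Lemma mu_mono a s r : ent a -> 0 < s -> s <= r -> mu a s <= mu a r.
Proof.
move=> ea s0 sr; apply: mu_le => n.
apply: (@le_trans _ _ (abs (a n) * r ^+ n)); last exact: (mu_ub absP n ea (lt_le_trans s0 sr)).
by rewrite ler_wpM2l ?(abs_ge0 absP)// lerXn2r ?nnegrE ?(ltW s0)// ltW// (lt_le_trans s0).
Qed.

Lemma series_to_unique a z v w : series_to abs a z v -> series_to abs a z w -> v = w.
Proof.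
move=> hv hw; apply/eqP; rewrite -subr_eq0 -(abs_eq0 absP).
apply/eqP/le_anti; rewrite (abs_ge0 absP) andbT; apply/ler_addgt0Pl => e e0.
rewrite addr0; have [N1 h1] := hv e e0; have [N2 h2] := hw e e0.
apply: le_trans (abs_dist_max absP _ (\sum_(i < N1 + N2) a i * z ^+ i) _) _.
by rewrite ge_max (abs_distC absP) (ltW (h1 _ _)) ?leq_addr//= (ltW (h2 _ _)) ?leq_addl.
Qed.

Lemma sum_tail a z m k : (m <= k)%N ->
  \sum_(i < k) a i * z ^+ i - \sum_(i < m) a i * z ^+ i = \sum_(m <= i < k) a i * z ^+ i.
Proof.
by move=> mk; rewrite -!(big_mkord xpredT (fun i => a i * z ^+ i)) (@big_cat_nat _ _ _ m)//= addrAC subrr add0r.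
Qed.

Lemma abs_term_le a z r n : abs z <= r -> abs (a n * z ^+ n) <= abs (a n) * r ^+ n.
Proof.
move=> zr; rewrite (absM absP) (absX absP) ler_wpM2l ?(abs_ge0 absP)//.
by rewrite lerXn2r ?nnegrE ?(abs_ge0 absP)// (le_trans (abs_ge0 absP z)).
Qed.

Lemma series_to_eval a z : ent a -> series_to abs a z (ev a z).
Proof.
move=> ea; rewrite /ent_eval; suff [v hv] : exists v, series_to abs a z v.
  by case: xgetP => [_ _ //|/(_ v)]; tauto.
have r0 : 0 < 1 + abs z by rewrite ltr_wpDr// (abs_ge0 absP).
have zr : abs z <= 1 + abs z by rewrite lerDr.
apply: absC => e e0; have [N hN] := ea _ r0 _ e0; exists N.
suff main m k : (N <= m)%N -> (m <= k)%N ->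
    abs (\sum_(i < k) a i * z ^+ i - \sum_(i < m) a i * z ^+ i) < e.
  move=> m k hm hk; case: (leqP m k) => [mk|/ltnW km]; last exact: main.
  by rewrite (abs_distC absP); exact: main.
move=> hm mk; rewrite sum_tail//; apply: (abs_sum_lt absP) => // i.
rewrite mem_index_iota => /andP[mi _] _; apply: le_lt_trans (abs_term_le _ _ zr) (hN _ _).
exact: leq_trans mi.
Qed.

Lemma evalE a z v : series_to abs a z v -> ev a z = v.
Proof.
move=> h; rewrite /ent_eval; case: xgetP => [w _ hw|/(_ v)//].
exact: series_to_unique hw h.
Qed.

Lemma eval_le a z r : ent a -> 0 < r -> abs z <= r -> abs (ev a z) <= mu a r.
Proof.
move=> ea r0 zr; apply/ler_addgt0Pl => e e0.
have [N h] := series_to_eval z ea e0.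
rewrite -[ev a z](subrK (\sum_(i < N) a i * z ^+ i)); apply: (absD_le absP).
  by rewrite (abs_distC absP); apply: (le_trans (ltW (h _ _))) => //; rewrite lerDl (mu_ge0 absP).
apply: (@le_trans _ _ (mu a r)); last by rewrite lerDr ltW.
apply: (abs_sum_le absP) => [|i _ _]; first exact: (mu_ge0 absP).
by apply: le_trans (abs_term_le _ _ zr) _; exact: (mu_ub absP).
Qed.

Lemma evalB a b z : ent a -> ent b -> ev (fun n => a n - b n) z = ev a z - ev b z.
Proof.
move=> ea eb; apply: evalE => e e0.
have [N1 h1] := series_to_eval z ea e0; have [N2 h2] := series_to_eval z eb e0.
exists (N1 + N2)%N => m hm.
have -> : \sum_(i < m) (a i - b i) * z ^+ i - (ev a z - ev b z) =
    (\sum_(i < m) a i * z ^+ i - ev a z) - (\sum_(i < m) b i * z ^+ i - ev b z).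
  rewrite (eq_bigr (fun i : 'I_m => a i * z ^+ i - b i * z ^+ i)) => [|i _].
    rewrite sumrB; ring.
  by rewrite mulrBl.
by apply: (absB_lt absP); [apply: h1|apply: h2]; lia.
Qed.

Lemma eval0 z : ev (fun=> 0) z = 0.
Proof.
have h : ev (fun n => (fun=> 0 : K) n - (fun=> 0 : K) n) z = 0.
  by rewrite evalB ?subrr//; exact: (entire0 absP).
by rewrite -[RHS]h; congr ent_eval; apply/funext => n; rewrite subr0.
Qed.

Lemma evalN a z : ent a -> ev (fun n => - a n) z = - ev a z.
Proof.
move=> ea; rewrite -[RHS]sub0r -[X in X - _](eval0 z) -evalB//; last exact: entire0.
by congr ent_eval; apply/funext => n; rewrite sub0r.
Qed.

Lemma entire_opp a : ent a -> ent (fun n => - a n).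
Proof.
move=> ea; have := entire_sub absP (entire0 absP) ea; congr is_entire.
by apply/funext => n; rewrite sub0r.
Qed.

Lemma evalD a b z : ent a -> ent b -> ev (fun n => a n + b n) z = ev a z + ev b z.
Proof.
move=> ea eb; rewrite -[ev b z]opprK -evalN// -evalB//; last exact: entire_opp.
by congr ent_eval; apply/funext => n; rewrite opprK.
Qed.

Lemma eval_poly p z : ev (cf p) z = p.[z].
Proof.
apply: evalE => e e0; exists (size p) => m hm.
suff -> : \sum_(i < m) p`_i * z ^+ i = p.[z] by rewrite subrr (abs0 absP).
by rewrite (horner_coef_wide _ hm).
Qed.

Definition trunc a m : {poly K} := \poly_(i < m) a i.

Lemma entire_poly_dense a r e : ent a -> 0 < r -> 0 < e ->
  exists N, forall m, (N <= m)%N -> mu (fun n => a n - (trunc a m)`_n) r <= e.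
Proof.
move=> ea r0 e0; have [N hN] := ea r r0 e e0; exists N => m hm.
apply: mu_le => n; rewrite coef_poly; case: ltnP => h.
  by rewrite subrr (abs0 absP) mul0r ltW.
by rewrite subr0 ltW// hN// (leq_trans hm).
Qed.

(* Polynomials are dense for the Gauss norm, so a bounded additive functional
   is determined by its values on polynomials. *)
Lemma functional_eq0 (Phi : (nat -> K) -> K) r C : 0 < r ->
  (forall a b, ent a -> ent b -> Phi (fun n => a n - b n) = Phi a - Phi b) ->
  (forall a, ent a -> abs (Phi a) <= C * mu a r) ->
  (forall p, Phi (cf p) = 0) -> forall a, ent a -> Phi a = 0.
Proof.
move=> r0 PhiB Phile Phip a ea; apply/eqP; rewrite -(abs_eq0 absP).
apply/eqP/le_anti; rewrite (abs_ge0 absP) andbT; apply/ler_addgt0Pl => e e0.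
have C0 : 0 < 1 + `|C| by rewrite ltr_wpDr.
have [N /(_ N (leqnn N)) hN] := entire_poly_dense ea r0 (divr_gt0 e0 C0).
have ep := entire_poly absP (trunc a N).
have es := entire_sub absP ea ep.
rewrite addr0; have -> : Phi a = Phi (fun n => a n - (trunc a N)`_n).
  by rewrite PhiB// Phip subr0.
apply: le_trans (Phile _ es) _; apply: (@le_trans _ _ ((1 + `|C|) * (e / (1 + `|C|)))).
  apply: (@le_trans _ _ ((1 + `|C|) * mu (fun n => a n - (trunc a N)`_n) r)).
    by rewrite ler_wpM2r ?(mu_ge0 absP)// (le_trans (ler_norm _))// lerDr.
  by rewrite ler_wpM2l ?(ltW C0).
by rewrite mulrC divfK// gt_eqF.
Qed.

Lemma ps_mulBl a b c : ps_mul (fun n => a n - b n) c =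
  (fun n => ps_mul a c n - ps_mul b c n).
Proof.
apply/funext => n; rewrite /ps_mul -sumrB; apply: eq_bigr => i _; exact: mulrBl.
Qed.

Lemma ps_mulBr a b c : ps_mul c (fun n => a n - b n) =
  (fun n => ps_mul c a n - ps_mul c b n).
Proof.
apply/funext => n; rewrite /ps_mul -sumrB; apply: eq_bigr => i _; exact: mulrBr.
Qed.

Lemma ps_mul_poly p q : ps_mul (cf p) (cf q) = cf (p * q).
Proof. by apply/funext => n; rewrite coefM. Qed.

Lemma evalM_defect a b z r : ent a -> ent b -> 0 < r -> abs z <= r ->
  abs (ev (ps_mul a b) z - ev a z * ev b z) <= mu a r * mu b r.
Proof.
move=> ea eb r0 zr; have em := entire_mul absP ea eb; apply: (absB_le absP).
  by rewrite -(mu_mul absP)//; exact: eval_le.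
by rewrite (absM absP) ler_pM ?(abs_ge0 absP)//; exact: eval_le.
Qed.

(** The defect of multiplicativity is bounded and additive in each factor, so density of polynomials
    applies to one factor at a time: the second while the first is a polynomial, then the first. *)
Lemma evalM a b z : ent a -> ent b -> ev (ps_mul a b) z = ev a z * ev b z.
Proof.
have r0 : 0 < 1 + abs z by rewrite ltr_wpDr// (abs_ge0 absP).
have zr : abs z <= 1 + abs z by rewrite lerDr.
have pM p c : ent c -> ev (ps_mul (cf p) c) z - ev (cf p) z * ev c z = 0.
  apply: (@functional_eq0 (fun c => ev (ps_mul (cf p) c) z - ev (cf p) z * ev c z)
    _ (mu (cf p) (1 + abs z)) r0).
  - move=> a' b' ea' eb'; rewrite ps_mulBr !evalB//; last 2 first.
    + exact: (entire_mul absP (entire_poly absP p)).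
    + exact: (entire_mul absP (entire_poly absP p)).
    ring.
  - by move=> a' ea' /=; apply: evalM_defect => //; exact: (entire_poly absP).
  - by move=> q; rewrite ps_mul_poly !eval_poly hornerM subrr.
move=> ea eb; apply/eqP; rewrite -subr_eq0; apply/eqP; move: a ea.
apply: (@functional_eq0 _ _ (mu b (1 + abs z)) r0).
- move=> a' b' ea' eb'; rewrite ps_mulBl !evalB//; try exact: (entire_mul absP).
  ring.
- by move=> a' ea' /=; rewrite [leRHS]mulrC; exact: evalM_defect.
- by move=> p; exact: pM.
Qed.

Definition shift a k : nat -> K := fun n => a (n + k)%N.

Lemma entire_shift a k : ent a -> ent (shift a k).
Proof.
move=> ea r r0 e e0; have rk : 0 < r ^+ k by exact: exprn_gt0.
have [N hN] := ea r r0 (e * r ^+ k) (mulr_gt0 e0 rk); exists N => n hn.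
rewrite -(ltr_pM2r rk) -mulrA -exprD; apply: hN; exact: (leq_trans hn (leq_addr _ _)).
Qed.

Definition lin w : nat -> K := cf ('X - w%:P).

Lemma linE w n : lin w n = (n == 1%N)%:R - w * (n == 0%N)%:R.
Proof. by rewrite /lin coefB coefX coefC; case: (n == 0%N); rewrite ?mulr1 ?mulr0. Qed.

Lemma ps_mul_lin w b n : ps_mul (lin w) b n.+1 = b n - w * b n.+1.
Proof.
rewrite /ps_mul big_ord_recl big_ord_recl /= big1 ?addr0 => [|i _].
  by rewrite !linE /= subn0 /bump /= subn1/=; ring.
by rewrite linE /=; ring.
Qed.

Lemma ps_mul_lin0 w b : ps_mul (lin w) b 0%N = - w * b 0%N.
Proof. by rewrite /ps_mul big_ord_recl big_ord0 linE/=; ring. Qed.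

Lemma entire_lin w : ent (lin w).
Proof. exact: (entire_poly absP). Qed.

Lemma eval_lin w z : ev (lin w) z = z - w.
Proof. by rewrite eval_poly !hornerE. Qed.

Lemma eval_shift a z : ent a -> ev a z = a 0%N + z * ev (shift a 1) z.
Proof.
move=> ea.
transitivity (ev (fun n => (a 0%N)%:P`_n + ps_mul (lin 0) (shift a 1) n) z).
  congr ent_eval; apply/funext => -[|n]; first by rewrite ps_mul_lin0 coefC/=; ring.
  by rewrite ps_mul_lin coefC/= /shift addn1; ring.
rewrite evalD; last 2 first.
- exact: (entire_poly absP).
- exact: (entire_mul absP (@entire_lin 0) (entire_shift 1 ea)).
rewrite evalM ?eval_lin ?eval_poly ?hornerE ?subr0//.
  exact: entire_lin.
exact: entire_shift.
Qed.

(** Synthetic division carried to infinity: the quotient has coefficients [b n], the sum over [m] of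
    [a (m + n + 1) * w ^+ m]. Working at a radius [s >= abs w] bounds these sums by a Gauss norm. *)
Lemma entire_divide a w : ent a -> ev a w = 0 ->
  exists2 b, ent b & a = ps_mul (lin w) b.
Proof.
move=> ea aw0; exists (fun n => ev (shift a n.+1) w).
  move=> r r0 e e0; pose s := Num.max r (1 + abs w).
  have s0 : 0 < s by rewrite lt_max r0.
  have ws : abs w <= s by rewrite le_max lerDr ler01 orbT.
  (* Half of [e], because a supremum of strictly bounded terms is only weakly bounded. *)
  have es : 0 < e / 2 * s by rewrite mulr_gt0// divr_gt0.
  have [N hN] := ea s s0 _ es; exists N => n hn.
  apply: (@le_lt_trans _ _ (e / 2)); last by rewrite ltr_pdivrMr// ltr_pMr// ltr1n.
  have sn : 0 < s ^+ n by exact: exprn_gt0.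
  apply: (@le_trans _ _ (abs (ev (shift a n.+1) w) * s ^+ n)).
    rewrite ler_wpM2l ?(abs_ge0 absP)// lerXn2r ?nnegrE ?(ltW r0) ?(ltW s0)//.
    by rewrite le_max lexx.
  rewrite -ler_pdivlMr//; apply: (le_trans (eval_le (entire_shift _ ea) s0 ws)).
  apply: mu_le => m; rewrite ler_pdivlMr// -mulrA -exprD -(ler_pM2r s0) -mulrA -exprSr.
  have -> : ((m + n).+1 = m + n.+1)%N by rewrite addnS.
  by apply/ltW/hN; lia.
apply/funext => -[|n].
  rewrite ps_mul_lin0 mulNr; apply/eqP; rewrite -addr_eq0; apply/eqP.
  by rewrite -eval_shift.
rewrite ps_mul_lin (eval_shift _ (entire_shift n.+1 ea)) /shift add0n.
rewrite (_ : (fun n0 => a (n0 + 1 + n.+1)%N) = (fun n0 => a (n0 + n.+2)%N)); first by ring.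
by apply/funext => m; congr a; lia.
Qed.

(** The index is a truth value read as a number: 1 if the root lies in the disc, 0 otherwise. *)
Lemma maxidx_lin w r : 0 < r -> maxidx abs (lin w) r (abs w <= r)%R.
Proof.
move=> r0 n; rewrite !linE; case: (leP (abs w) r) => h /=.
  rewrite mulr0 subr0 (abs1 absP) mul1r expr1; case: n => [|[|n]] /=.
  - by rewrite sub0r mulr1 (absN absP) ?expr0 ?mulr1.
  - by rewrite mulr0 subr0 (abs1 absP) mul1r expr1.
  - by rewrite mulr0 subr0 (abs0 absP) mul0r; rewrite (ltW r0).
rewrite sub0r mulr1 (absN absP) ?expr0 ?mulr1; case: n => [|[|n]] /=.
- by rewrite sub0r mulr1 (absN absP) ?expr0 ?mulr1.
- by rewrite mulr0 subr0 (abs1 absP) mul1r expr1; rewrite (ltW h).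
- by rewrite mulr0 subr0 (abs0 absP) mul0r (abs_ge0 absP); split=> // _; exact: (lt_trans r0 h).
Qed.

Lemma mu_lin w r : 0 < r -> mu (lin w) r = Num.max r (abs w).
Proof.
move=> r0; rewrite (maxidx_mu (maxidx_lin w r0)) !linE.
case: leP => h /=; first by rewrite mulr0 subr0 (abs1 absP) mul1r expr1.
by rewrite sub0r mulr1 (absN absP) ?expr0 ?mulr1.
Qed.

End Evaluation.

(** * Zeros in a disc *)

Section Zeros.
Variables (R : realType) (K : closedFieldType) (abs : K -> R).
Hypothesis absP : is_na_abs abs.
Hypothesis absC : abs_complete abs.
Local Notation ent := (is_entire abs).
Local Notation mu := (mu_ent abs).
Local Notation ev := (ent_eval abs).
Local Notation cf p := (fun n => (p : {poly K})`_n).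
Implicit Types (a b : nat -> K) (r : R) (p q : {poly K}) (z w : K).

Lemma maxidx_unique a r i j : maxidx abs a r i -> maxidx abs a r j -> i = j.
Proof.
wlog ij : i j / (i < j)%N.
  move=> h hi hj; case: (ltngtP i j) => // c; first exact: h.
  by apply/esym/h.
by move=> /(_ j)[_ /(_ ij) h] /(_ i)[]; rewrite leNgt h.
Qed.

Lemma maxidx_prod_lin (s : seq K) r : 0 < r ->
  maxidx abs (cf (\prod_(w <- s) ('X - w%:P))) r (count (fun w => abs w <= r) s) /\
  mu (cf (\prod_(w <- s) ('X - w%:P))) r = \prod_(w <- s) Num.max r (abs w).
Proof.
move=> r0; elim: s => [|w s [IH1 IH2]].
  have h : maxidx abs (cf (1 : {poly K})) r 0.
    move=> [|n]; rewrite !coef1 /= (abs1 absP) ?(abs0 absP) ?mul0r ?expr0 ?mulr1 ?ltr01 ?ler01//.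
  by rewrite !big_nil; split => //; rewrite (maxidx_mu h) coef1 (abs1 absP) expr0 mulr1.
rewrite !big_cons -ps_mul_poly.
have [h1 h2] := maxidx_mul_mu absP r0 (maxidx_lin absP w r0) IH1.
by split; [exact: h1|rewrite [LHS]h2 (mu_lin absP)// IH2].
Qed.

Lemma maxidx_scale a (x : K) r k : 0 < r -> x != 0 -> maxidx abs a r k ->
  maxidx abs (fun n => x * a n) r k /\ mu (fun n => x * a n) r = abs x * mu a r.
Proof.
move=> r0 x0 h.
have h' : maxidx abs (fun n => x * a n) r k.
  move=> n; rewrite !(absM absP) -!mulrA ler_pM2l ?(abs_gt0 absP)//.
  by rewrite ltr_pM2l ?(abs_gt0 absP)//; exact: h.
by split=> //; rewrite (maxidx_mu h) (maxidx_mu h') (absM absP) mulrA.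
Qed.

Lemma seq_argmin (T : eqType) (f : T -> R) (s : seq T) : s != [::] ->
  exists2 w, w \in s & forall v, v \in s -> f w <= f v.
Proof.
elim: s => // w [|v s] IH _.
  by exists w; rewrite ?mem_head// => u; rewrite inE => /eqP ->.
have [u us hu] := IH isT; case: (leP (f w) (f u)) => h.
  exists w; rewrite ?mem_head// => t; rewrite inE => /orP[/eqP->//|/hu].
  exact: le_trans.
exists u; first by rewrite inE us orbT.
by move=> t; rewrite inE => /orP[/eqP ->|/hu//]; exact: ltW.
Qed.

(** Roots outside the disc satisfy [abs (x - w) = abs w] and contribute equally to both sides; each
    root inside trades a factor [r] for its distance to [x], at least [d]. *)
Lemma prod_dist_ge (s : seq K) x r (d : R) : 0 < r -> abs x <= r -> 0 <= d ->
  (forall w, w \in s -> abs w <= r -> d <= abs (x - w)) ->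
  \prod_(w <- s) Num.max r (abs w) * d ^+ (count (fun w => abs w <= r) s)
    <= r ^+ (count (fun w => abs w <= r) s) * \prod_(w <- s) abs (x - w).
Proof.
move=> r0 xr d0; elim: s => [|w s IH] hs; first by rewrite !big_nil !expr0.
have {}IH := IH (fun v vs => hs v (@mem_behead _ (w :: s) v vs)).
have hM : 0 <= \prod_(v <- s) Num.max r (abs v).
  by apply: prodr_ge0 => v _; rewrite le_max (ltW r0).
rewrite !big_cons /=; case: (leP (abs w) r) => h /=.
  rewrite !add1n !exprS mulrACA [leRHS]mulrACA; apply: ler_pM => //.
  - by rewrite mulr_ge0// ltW.
  - by rewrite mulr_ge0// exprn_ge0.
  by rewrite ler_wpM2l ?(ltW r0)// hs ?mem_head.
rewrite !add0n -mulrA [leRHS]mulrCA; have -> : abs (x - w) = abs w.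
  by rewrite (abs_distC absP) (absD_eq absP)// (absN absP) (le_lt_trans xr).
by rewrite ler_wpM2l// (abs_ge0 absP).
Qed.

(** A small value [p.[x]] forces a root close to [x]. The witness is the root in the disc nearest to
    [x]: its distance bounds from below those of all [k.+1] roots there. *)
Lemma near_root p r k x : 0 < r -> maxidx abs (cf p) r k.+1 -> abs x <= r ->
  exists w, [/\ abs w <= r, p.[w] = 0 &
    abs (x - w) ^+ k.+1 * mu (cf p) r <= r ^+ k.+1 * abs p.[x]].
Proof.
move=> r0 hp xr; have [s ps] := closed_field_poly_normal p.
set c := lead_coef p in ps; set q := \prod_(z <- s) _ in ps.
have c0 : c != 0.
  rewrite lead_coef_eq0; have := maxidx_neq0 absP r0 hp.
  by apply: contraNneq => ->; rewrite coef0.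
have [h1 h2] := maxidx_prod_lin s r0.
have [h3 h4] := maxidx_scale r0 c0 h1.
have pE : cf p = (fun n => c * q`_n) by apply/funext => n; rewrite ps coefZ.
have ks : count (fun w => abs w <= r) s = k.+1.
  by apply: (maxidx_unique h3); rewrite -/q -pE.
have [|w] := @seq_argmin K (fun w => abs (x - w)) [seq w <- s | abs w <= r].
  by rewrite -size_eq0 size_filter ks.
rewrite mem_filter => /andP[wr ws] hw; exists w; split => //.
  rewrite ps hornerZ horner_prod (big_rem w ws)/=.
  by rewrite hornerXsubC subrr mul0r mulr0.
have -> : mu (cf p) r = abs c * \prod_(w <- s) Num.max r (abs w).
  by rewrite pE; move: h4; rewrite h2.
rewrite ps hornerZ (absM absP) horner_prod (abs_prod absP).
rewrite [leLHS]mulrCA [leRHS]mulrCA ler_wpM2l ?(abs_ge0 absP)//.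
rewrite [leLHS]mulrC -ks; under [X in _ <= _ * X]eq_bigr do rewrite hornerXsubC.
by apply: prod_dist_ge => // [|v vs vr]; [exact: (abs_ge0 absP)|apply: hw; rewrite mem_filter vr].
Qed.

Lemma maxidx_trunc a r k m : 0 < r -> maxidx abs a r k -> (k < m)%N ->
  maxidx abs (cf (trunc a m)) r k.
Proof.
move=> r0 h km n; rewrite !coef_poly km; case: ltnP => nm; first exact: h.
have hk := maxidx_gt0 absP r0 h.
by rewrite (abs0 absP) mul0r (ltW hk) hk.
Qed.

Lemma absX_sub_le x y r n : 0 < r -> abs x <= r -> abs y <= r ->
  abs (x ^+ n - y ^+ n) * r <= abs (x - y) * r ^+ n.
Proof.
move=> r0 xr yr; elim: n => [|n IH].
  by rewrite !expr0 subrr (abs0 absP) mul0r mulr1 (abs_ge0 absP).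
have -> : x ^+ n.+1 - y ^+ n.+1 = x * (x ^+ n - y ^+ n) + (x - y) * y ^+ n.
  by rewrite !exprS; ring.
rewrite -ler_pdivlMr//; apply: (absD_le absP); rewrite ler_pdivlMr// (absM absP).
  rewrite -mulrA exprS [leRHS]mulrCA ler_pM ?(abs_ge0 absP)//.
  by rewrite mulr_ge0 ?(abs_ge0 absP)// ltW.
rewrite -mulrA ler_wpM2l ?(abs_ge0 absP)// exprSr ler_wpM2r ?(ltW r0)// (absX absP).
by rewrite lerXn2r ?nnegrE ?(abs_ge0 absP) ?(ltW r0).
Qed.

(* The zero is the limit of a Cauchy sequence of zeros of the truncations, each
   root being chosen closest to the previous one. *)
Lemma entire_zero_exists a r k : ent a -> 0 < r -> maxidx abs a r k.+1 ->
  exists2 w, abs w <= r & ev a w = 0.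
Proof.
move=> ea r0 ha; pose M := mu a r.
have M0 : 0 < M by rewrite /M (maxidx_mu ha); exact: (maxidx_gt0 absP r0 ha).
(* Truncations start at length [k.+2] so that the dominant index [k.+1] is always kept. *)
have hp m : maxidx abs (cf (trunc a (m + k.+2))) r k.+1.
  by apply: maxidx_trunc => //; rewrite addnS ltnS leq_addl.
have muM m : mu (cf (trunc a (m + k.+2))) r = M.
  rewrite (maxidx_mu (hp m)) /M (maxidx_mu ha) coef_poly ifT//.
  by rewrite addnS ltnS leq_addl.
have step (mx : nat * K) : exists y, abs mx.2 <= r ->
    [/\ abs y <= r, (trunc a (mx.1 + k.+2)).[y] = 0 &
     abs (mx.2 - y) ^+ k.+1 * M <= r ^+ k.+1 * abs (trunc a (mx.1 + k.+2)).[mx.2]].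
  case: (leP (abs mx.2) r) => [h|_]; last by exists 0.
  have [w [w1 w2 w3]] := near_root r0 (hp mx.1) h.
  by exists w => _; split=> //; rewrite -(muM mx.1).
have [g hg] := choice step.
pose x := fix x m := if m is m'.+1 then g (m', x m') else 0.
have xr m : abs (x m) <= r.
  by elim: m => [|m /(hg (m, _))[]//]; rewrite (abs0 absP) ltW.
pose y m := x m.+1.
have y0 m : (trunc a (m + k.+2)).[y m] = 0 by have [] := hg (m, x m) (xr m).
(* Since [y m] kills the truncation it came from, the next truncation takes at [y m] the value of
   its one new monomial, which tends to 0. *)
have ystep m : abs (y m - y m.+1) ^+ k.+1 * M <=
    r ^+ k.+1 * (abs (a (m + k.+2)%N) * r ^+ (m + k.+2)).
  have [_ _ h] := hg (m.+1, x m.+1) (xr m.+1).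
  apply: le_trans h _; rewrite ler_wpM2l ?exprn_ge0 ?(ltW r0)//=.
  rewrite addSn /trunc horner_poly big_ord_recr /= -horner_poly.
  rewrite [X in X + _](y0 m) add0r; apply: (abs_term_le absP); exact: (xr m.+1).
have cauchy e : 0 < e -> exists N, forall m j, (N <= m)%N -> abs (y m - y (m + j)%N) < e.
  move=> e0; have e'0 : 0 < e ^+ k.+1 * M / r ^+ k.+1.
    by rewrite divr_gt0 ?mulr_gt0 ?exprn_gt0.
  have [N hN] := ea r r0 _ e'0; exists N => m j Nm.
  elim: j => [|j IH]; first by rewrite addn0 subrr (abs0 absP).
  apply: (le_lt_trans (abs_dist_max absP _ (y (m + j)%N) _)); rewrite gt_max IH/= addnS.
  have h := ystep (m + j)%N.
  have {}h : abs (y (m + j)%N - y (m + j).+1) ^+ k.+1 * M < e ^+ k.+1 * M.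
    apply: (le_lt_trans h); rewrite mulrC -ltr_pdivlMr ?exprn_gt0//; apply: hN; lia.
  by move: h; rewrite ltr_pM2r// ltr_pXn2r// ?nnegrE ?(abs_ge0 absP) ?(ltW e0).
have [l hl] : exists l, forall e, 0 < e -> exists N, forall m, (N <= m)%N -> abs (y m - l) < e.
  apply: absC => e e0; have [N hN] := cauchy e e0; exists N => m j Nm Nj.
  case: (leqP m j) => [h|/ltnW h]; first by rewrite -(subnKC h) hN.
  by rewrite -(subnKC h) (abs_distC absP) hN.
have lr : abs l <= r.
  have [N /(_ N (leqnn N)) hN] := hl r r0.
  rewrite -[l](subrK (y N)); apply: (absD_le absP); last exact: (xr N.+1).
  by rewrite (abs_distC absP) ltW.
exists l => //; apply: (evalE absP) => e e0.
(* The partial sum at [l] is compared term by term with the vanishing one at [y j]; by [absX_sub_le]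
   each difference is at most [M * abs (l - y j) / r], whence the tolerance. *)
have [N hN] := hl (e / M * r) (mulr_gt0 (divr_gt0 e0 M0) r0).
exists (N + k.+2)%N => m hm; rewrite subr0.
have -> : m = ((m - k.+2) + k.+2)%N by lia.
set j := (m - k.+2)%N; have jN : (N <= j)%N by rewrite /j; lia.
have := y0 j; rewrite /trunc horner_poly => y0j.
rewrite -[X in abs X]subr0 -[X in abs (_ - X)]y0j -sumrB; apply: (abs_sum_lt absP) => // i _ _.
rewrite -mulrBr (absM absP) -(ltr_pM2r r0) -mulrA.
apply: (@le_lt_trans _ _ (M * abs (l - y j))).
  apply: (@le_trans _ _ (abs (a i) * (abs (l - y j) * r ^+ i))).
    by rewrite ler_wpM2l ?(abs_ge0 absP)//; exact: (absX_sub_le i r0 lr (xr j.+1)).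
  by rewrite mulrCA [leRHS]mulrC ler_wpM2l ?(abs_ge0 absP)// (mu_ub absP).
by rewrite -ltr_pdivlMl// mulrA (mulrC _ e) (abs_distC absP) hN.
Qed.

End Zeros.

(** * Factorization and orders of vanishing *)

Section Factorization.
Variables (R : realType) (K : closedFieldType) (abs : K -> R).
Hypothesis absP : is_na_abs abs.
Hypothesis absC : abs_complete abs.
Local Notation ent := (is_entire abs).
Local Notation mu := (mu_ent abs).
Local Notation ev := (ent_eval abs).
Local Notation cf p := (fun n => (p : {poly K})`_n).
Implicit Types (a b u : nat -> K) (r : R) (p q : {poly K}) (z w : K).

Definition linprod (s : seq K) u := foldr (fun w b => ps_mul (lin w) b) u s.

Lemma maxidx_divide w b r k : ent b -> 0 < r -> abs w <= r ->
  maxidx abs (ps_mul (lin w) b) r k -> exists2 j, k = j.+1 & maxidx abs b r j.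
Proof.
move=> eb r0 wr h.
have [b0|[n bn]] := seq_eq0P b.
  by have := maxidx_neq0 absP r0 h; rewrite b0 ps_mul0r eqxx.
have [j hj] := maxidx_exists absP eb r0 bn; exists j => //.
have [h' _] := maxidx_mul_mu absP r0 (maxidx_lin absP w r0) hj.
by rewrite (maxidx_unique h h') wr.
Qed.

(** Weierstrass preparation on a disc: each zero divided out lowers the degree by one, and at degree
    0 the remaining factor has no zero in the disc. *)
Lemma entire_factor a r k : ent a -> 0 < r -> maxidx abs a r k ->
  exists s u, [/\ a = linprod s u, ent u, maxidx abs u r 0 &
    forall w, w \in s -> abs w <= r].
Proof.
elim: k a => [|k IH] a ea r0 ha; first by exists [::], a.
have [w wr aw] := entire_zero_exists absP absC ea r0 ha.
have [b eb ab] := entire_divide absP absC ea aw.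
move: ha; rewrite ab => /(maxidx_divide eb r0 wr)[j [<-] hb].
have [s [u [bs eu hu hs]]] := IH b eb r0 hb.
exists (w :: s), u; rewrite /= -bs; split=> // v; rewrite inE => /orP[/eqP->//|].
exact: hs.
Qed.

Lemma entire_linprod s u : ent u -> ent (linprod s u).
Proof.
by move=> eu; elim: s => //= w s IH; apply: (entire_mul absP) => //; exact: (entire_lin absP).
Qed.

Lemma eval_linprod s u z : ent u ->
  ev (linprod s u) z = \prod_(w <- s) (z - w) * ev u z.
Proof.
move=> eu; elim: s => [|w s IH] /=; first by rewrite big_nil mul1r.
rewrite (evalM absP absC)// ?IH ?(eval_lin absP)// ?big_cons ?mulrA//.
  exact: (entire_lin absP).
exact: entire_linprod.
Qed.

Lemma maxidx0_neq0 u r z : ent u -> 0 < r -> maxidx abs u r 0 -> abs z <= r ->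
  ev u z != 0.
Proof.
move=> eu r0 hu zr; apply/eqP => uz.
have [b eb ub] := entire_divide absP absC eu uz.
by move: hu; rewrite ub => /(maxidx_divide eb r0 zr)[].
Qed.

(** A constant term that dominates at radius [r] dominates at every smaller one, so the zero-free
    factor contributes nothing to the growth of the norm. *)
Lemma mu_maxidx0 u r t : 0 < t -> t <= r -> maxidx abs u r 0 -> mu u t = abs (u 0%N).
Proof.
move=> t0 tr hu; have r0 := lt_le_trans t0 tr.
suff h : maxidx abs u t 0 by rewrite (maxidx_mu h) expr0 mulr1.
have le n : abs (u n) * t ^+ n <= abs (u n) * r ^+ n.
  by rewrite ler_wpM2l ?(abs_ge0 absP)// lerXn2r ?nnegrE ?(ltW t0) ?(ltW r0).
move=> n; have [h1 h2] := hu n; rewrite !expr0 in h1 h2 *; split; first exact: le_trans h1.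
by move=> n0; apply: le_lt_trans (le n) (h2 n0).
Qed.

(** The Hasse derivative of order [k], that is the derivative divided by [k!]; its value at [z] is
    the Taylor coefficient there. *)
Definition hasse a k : nat -> K := fun n => a (n + k)%N * ('C(n + k, k))%:R.

Lemma abs_hasse a k n : abs (hasse a k n) <= abs (a (n + k)%N).
Proof. by rewrite (absM absP) ler_piMr ?(abs_ge0 absP)// (abs_nat absP). Qed.

Lemma entire_hasse a k : ent a -> ent (hasse a k).
Proof.
move=> /(entire_shift k) ea r r0 e e0; have [N h] := ea r r0 e e0.
exists N => n /h; apply: le_lt_trans; rewrite ler_wpM2r ?abs_hasse//.
by rewrite exprn_ge0// ltW.
Qed.

(** The Leibniz rule for a linear factor; on coefficients it is Pascal's identity. *)
Lemma taylor_coef_lin b w z k : ent b ->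
  taylor_coef abs (ps_mul (lin w) b) z k.+1 =
    (z - w) * taylor_coef abs b z k.+1 + taylor_coef abs b z k.
Proof.
move=> eb; rewrite /taylor_coef -/(hasse _ k.+1) -/(hasse b k.+1) -/(hasse b k).
rewrite -(eval_lin absP w z) -(evalM absP absC); last 2 first.
- exact: (entire_lin absP).
- exact: entire_hasse.
rewrite -(evalD absP absC); last 2 first.
- by apply: (entire_mul absP); [exact: (entire_lin absP)|exact: entire_hasse].
- exact: entire_hasse.
congr ent_eval; apply/funext => -[|n]; rewrite /hasse.
  rewrite !add0n ps_mul_lin ps_mul_lin0 add0n !binn; ring.
rewrite ps_mul_lin addnS ps_mul_lin -addSnnS addSn binS natrD -addnS; ring.
Qed.

Lemma taylor_coef0 a z : taylor_coef abs a z 0 = ev a z.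
Proof.
by rewrite /taylor_coef; congr ent_eval; apply/funext => n; rewrite addn0 bin0 mulr1.
Qed.

Lemma taylor_coef_linprod s u z : ent u -> ev u z != 0 ->
  taylor_coef abs (linprod s u) z (count_mem z s) != 0 /\
  forall j, (j < count_mem z s)%N -> taylor_coef abs (linprod s u) z j = 0.
Proof.
move=> eu uz; elim: s => [|w s [IH1 IH2]]; first by rewrite /= taylor_coef0.
have es := entire_linprod s eu.
have t0 : taylor_coef abs (ps_mul (lin w) (linprod s u)) z 0 =
    (z - w) * taylor_coef abs (linprod s u) z 0.
  by rewrite !taylor_coef0 (evalM absP absC)// ?(eval_lin absP)//; exact: (entire_lin absP).
rewrite /=; have [wz|wz] := eqVneq w z.
  rewrite add1n; split; first by rewrite taylor_coef_lin// wz subrr mul0r add0r.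
  move=> [_|j]; first by rewrite t0 wz subrr mul0r.
  by rewrite ltnS => /IH2 h; rewrite taylor_coef_lin// wz subrr mul0r add0r.
have zw : z - w != 0 by rewrite subr_eq0 eq_sym.
rewrite add0n; split.
  case E : (count_mem z s) => [|c]; first by rewrite t0 mulf_neq0// -E.
  by rewrite taylor_coef_lin// (IH2 c) ?E// addr0 mulf_neq0// -E.
move=> [|j] h; first by rewrite t0 IH2 ?mulr0.
by rewrite taylor_coef_lin// !IH2 ?mulr0 ?addr0//; exact: ltnW.
Qed.

Lemma ent_ord_linprod s u z : ent u -> ev u z != 0 ->
  ent_ord abs (linprod s u) z = count_mem z s.
Proof.
move=> eu uz; have [h1 h2] := taylor_coef_linprod s eu uz.
rewrite /ent_ord; case: xgetP => [k _ [k1 k2]|/(_ (count_mem z s))]; last by case.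
apply/eqP; rewrite eqn_leq; apply/andP; split; rewrite leqNgt; apply/negP.
  by move=> /k2 /eqP; rewrite (negPf h1).
by move=> /h2 /eqP; rewrite (negPf k1).
Qed.

End Factorization.

(** * Composition with affine maps *)

Section Composition.
Variables (R : realType) (K : closedFieldType) (abs : K -> R).
Hypothesis absP : is_na_abs abs.
Hypothesis absC : abs_complete abs.
Local Notation ent := (is_entire abs).
Local Notation mu := (mu_ent abs).
Local Notation ev := (ent_eval abs).
Local Notation cf p := (fun n => (p : {poly K})`_n).
Implicit Types (a b u : nat -> K) (r : R) (p q : {poly K}) (z w : K).
Variables (al be : K).
Hypothesis al1 : abs al = 1.

(** Taylor expansion at [be], rescaled by [al]: the coefficients of the composite with
    [al * z + be]. *)
Definition affcomp a : nat -> K := fun k => al ^+ k * ev (hasse a k) be.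

(** The coefficient of index [k] involves only [a n] with [n >= k]. Restricting the bound to these
    indices lets one estimate serve both the norm inequality and the decay that makes the composite
    entire. *)
Lemma abs_affcomp_le a r k M : ent a -> 0 < r -> abs be <= r ->
  (forall n, (k <= n)%N -> abs (a n) * r ^+ n <= M) ->
  abs (affcomp a k) * r ^+ k <= M.
Proof.
move=> ea r0 br h; have rk : 0 < r ^+ k by exact: exprn_gt0.
rewrite (absM absP) (absX absP) al1 expr1n mul1r -ler_pdivlMr//.
apply: (le_trans (eval_le absP absC (entire_hasse absP k ea) r0 br)).
apply: mu_le => n; rewrite ler_pdivlMr// -mulrA -exprD.
apply: le_trans (h (n + k)%N (leq_addl _ _)); rewrite ler_wpM2r ?(abs_hasse absP)//.
by rewrite exprn_ge0// ltW.
Qed.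

Lemma mu_affcomp_le a r : ent a -> 0 < r -> abs be <= r -> mu (affcomp a) r <= mu a r.
Proof.
move=> ea r0 br; apply: mu_le => k; apply: abs_affcomp_le => // n _.
exact: (mu_ub absP).
Qed.

Lemma entire_affcomp a : ent a -> ent (affcomp a).
Proof.
move=> ea r r0 e e0; pose s := Num.max r (abs be).
have s0 : 0 < s by rewrite lt_max r0.
have e2 : 0 < e / 2 by rewrite divr_gt0.
have [N hN] := ea s s0 _ e2; exists N => n hn.
apply: (@le_lt_trans _ _ (e / 2)); last by rewrite ltr_pdivrMr// ltr_pMr// ltr1n.
apply: (@le_trans _ _ (abs (affcomp a n) * s ^+ n)).
  rewrite ler_wpM2l ?(abs_ge0 absP)// lerXn2r ?nnegrE ?(ltW r0) ?(ltW s0)//.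
  by rewrite le_max lexx.
apply: abs_affcomp_le => // [|m nm]; first by rewrite le_max lexx orbT.
by apply/ltW/hN; lia.
Qed.

Lemma affcompB a b : ent a -> ent b ->
  affcomp (fun n => a n - b n) = (fun n => affcomp a n - affcomp b n).
Proof.
move=> ea eb; apply/funext => k; rewrite /affcomp -mulrBr; congr (_ * _).
rewrite -(evalB absP absC); try exact: (entire_hasse absP).
by congr ent_eval; apply/funext => n; rewrite /hasse mulrBl.
Qed.

Lemma affcomp_poly p :
  affcomp (cf p) = cf (\poly_(i < size p) (al ^+ i * p^`N(i).[be])).
Proof.
apply/funext => k; rewrite coef_poly /affcomp.
have -> : hasse (cf p) k = cf (p^`N(k)).
  by apply/funext => n; rewrite /hasse coef_nderivn addnC mulr_natr.
rewrite (eval_poly absP); case: ltnP => // h.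
by rewrite nderivn_poly0// horner0 mulr0.
Qed.

(** The difference of the two sides is a bounded additive functional on a disc containing [z] and
    [be], so Taylor's formula for polynomials suffices. *)
Lemma eval_affcomp a z : ent a -> ev (affcomp a) z = ev a (al * z + be).
Proof.
move=> ea; apply/eqP; rewrite -subr_eq0; apply/eqP; move: a ea.
pose r := 1 + Num.max (abs z) (abs be).
have r0 : 0 < r by rewrite ltr_wpDr// le_max (abs_ge0 absP).
have zr : abs z <= r by rewrite ler_wpDl// le_max lexx.
have br : abs be <= r by rewrite ler_wpDl// le_max lexx orbT.
apply: (@functional_eq0 _ _ _ absP (fun a => ev (affcomp a) z - ev a (al * z + be)) r 1 r0).
- move=> a b ea eb; rewrite affcompB// !(evalB absP absC)//; last 2 first.
  + exact: entire_affcomp.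
  + exact: entire_affcomp.
  ring.
- move=> a ea; rewrite mul1r; apply: (absB_le absP).
    apply: le_trans (mu_affcomp_le ea r0 br).
    by apply: (eval_le absP absC) => //; exact: entire_affcomp.
  apply: (eval_le absP absC) => //; apply: (absD_le absP) => //.
  by rewrite (absM absP) al1 mul1r.
- move=> p; rewrite affcomp_poly !(eval_poly absP) horner_poly.
  rewrite (addrC (al * z)) nderiv_taylor; last exact: mulrC.
  apply/eqP; rewrite subr_eq0; apply/eqP; apply: eq_bigr => i _.
  by rewrite exprMn; ring.
Qed.

End Composition.

(** * The identity theorem *)

Section Identity.
Variables (R : realType) (K : closedFieldType) (abs : K -> R).
Hypothesis absP : is_na_abs abs.
Hypothesis absC : abs_complete abs.
Hypothesis char0 : [pchar K] =i pred0.
Local Notation ev := (ent_eval abs).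

(** All natural numbers lie in the unit disc, and in characteristic zero they are pairwise distinct,
    whereas a non-zero series has only finitely many zeros there. *)
Lemma eval_eq0 a : is_entire abs a -> (forall z, ev a z = 0) -> a = fun=> 0.
Proof.
move=> ea h; have [//|[n an]] := seq_eq0P a.
have [k hk] := maxidx_exists absP ea ltr01 an.
have [s [u [as_ eu hu hs]]] := entire_factor absP absC ea ltr01 hk.
pose t := [seq (i%:R : K) | i <- iota 0 (size s).+1].
have ut : uniq t.
  rewrite map_inj_uniq ?iota_uniq// => i j /eqP; rewrite -subr_eq0.
  wlog ij : i j / (i <= j)%N.
    by move=> H; case: (leqP i j) => [/H//|/ltnW /H {}H e]; apply/esym/H; rewrite -opprB oppr_eq0.
  rewrite -oppr_eq0 opprB -natrB// => /eqP /eqP; rewrite ((pcharf0P K).1 char0).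
  by rewrite subn_eq0 => ji; apply/eqP; rewrite eqn_leq ij.
suff /(uniq_leq_size ut) : {subset t <= s} by rewrite size_map size_iota ltnn.
move=> _ /mapP[i _ ->]; have := h i%:R; rewrite as_ (eval_linprod absP absC)// => /eqP.
rewrite mulf_eq0 (negPf (maxidx0_neq0 absP absC eu ltr01 hu (abs_nat absP i))) orbF.
by rewrite prodf_seq_eq0 => /hasP[w ws /=]; rewrite subr_eq0 => /eqP ->.
Qed.

End Identity.

(** * Counting functions *)

Section LogIntegral.
Import numFieldNormedType.Exports.
Local Open Scope classical_set_scope.
Variable R : realType.
Local Notation leb := (@lebesgue_measure R).
Implicit Types r rho t : R.

Lemma inv_within_continuous rho r : 0 < rho ->
  {within `[rho, r]%classic, continuous (fun t : R => t^-1 : R^o)}.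
Proof.
move=> rho0; apply: continuous_in_subspaceT => t; rewrite inE /= in_itv /= => /andP[h _].
by apply: inv_continuous; rewrite gt_eqF// (lt_le_trans rho0).
Qed.

Lemma Rintegral_inv rho r : 0 < rho -> rho <= r ->
  Rintegral leb `[rho, r]%classic (fun t => t^-1) = ln (r / rho).
Proof.
move=> rho0; rewrite le_eqVlt => /orP[/eqP <-|h].
  by rewrite divff ?gt_eqF// ln1 set_itv1 Rintegral_set1.
have r0 : 0 < r := lt_trans rho0 h.
rewrite /Rintegral (@continuous_FTC2 _ _ (@ln R))//.
- by rewrite /= ln_div// ?posrE.
- exact: inv_within_continuous.
- split.
  + move=> t; rewrite in_itv /= => /andP[t1 _]; apply: ex_derive.
    by apply: is_derive1_ln; exact: lt_trans t1.
  + by apply: cvg_at_right_filter; exact: continuous_ln.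
  + by apply: cvg_at_left_filter; exact: continuous_ln.
- move=> t; rewrite in_itv /= => /andP[t1 _]; rewrite derive1E.
  have := is_derive1_ln (lt_trans rho0 t1) => ?; exact: derive_val.
Qed.

Lemma step_inv_patch rho r : 0 < rho ->
  {in `]0, r]%classic, (fun t : R => t^-1) \_ `[rho, r]%classic =1
     (fun t => (rho <= t)%R%:R / t)}.
Proof.
move=> rho0 t; rewrite inE /= in_itv /= => /andP[t0 tr]; rewrite patchE mem_setE in_itv/= tr andbT.
by case: leP => _; rewrite ?mul1r ?mul0r.
Qed.

Lemma itv_capE rho r : 0 < rho -> (`]0, r] `&` `[rho, r] = `[rho, r] :> set R)%classic.
Proof.
move=> rho0; apply/seteqP; split => t /=; rewrite !in_itv /=; first by case.
by move=> /andP[h1 h2]; rewrite h1 h2 (lt_le_trans rho0 h1).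
Qed.

Lemma integrable_step_inv rho r : 0 < rho ->
  leb.-integrable `]0, r]%classic (EFin \o (fun t => (rho <= t)%R%:R / t)).
Proof.
move=> rho0.
have h : leb.-integrable `]0, r] ((EFin \o (fun t : R => t^-1)) \_ `[rho, r]).
  apply/integrable_restrict => //; rewrite itv_capE//.
  apply: continuous_compact_integrable; first exact: segment_compact.
  exact: inv_within_continuous.
apply: eq_integrable h => // t th.
by rewrite restrict_EFin /= (step_inv_patch rho0 th).
Qed.

Lemma Rintegral_step_inv rho r : 0 < rho -> rho <= r ->
  Rintegral leb `]0, r]%classic (fun t => (rho <= t)%R%:R / t) = ln (r / rho).
Proof.
move=> rho0 h; rewrite -Rintegral_inv// -(itv_capE r rho0) Rintegral_mkcondr.
by apply/esym/eq_Rintegral; exact: step_inv_patch.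
Qed.

(** The counting function is a sum of unit steps, each contributing one logarithm. Integrability is
    carried through the induction because additivity of the integral asks for it. *)
Lemma Rintegral_count (s : seq R) r : (forall x, x \in s -> 0 < x <= r) ->
  leb.-integrable `]0, r]%classic (EFin \o (fun t => (count (fun x => x <= t) s)%:R / t)) /\
  Rintegral leb `]0, r]%classic (fun t => (count (fun x => x <= t) s)%:R / t) =
    \sum_(x <- s) ln (r / x).
Proof.
elim: s => [|x s IH] h.
  have e : (fun t : R => (count (fun x => x <= t) [::])%:R / t) = fun=> 0.
    by apply/funext => t; rewrite mul0r.
  rewrite e big_nil; split; first exact: integrable0.
  by rewrite /Rintegral integral0_eq.
have [IH1 IH2] := IH (fun y ys => h y (@mem_behead _ (x :: s) y ys)).
have /andP[x0 xr] := h x (mem_head _ _).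
have e : (fun t : R => (count (fun x => x <= t) (x :: s))%:R / t) =
    fun t => (x <= t)%R%:R / t + (count (fun x => x <= t) s)%:R / t.
  by apply/funext => t; rewrite /= natrD mulrDl.
rewrite e big_cons; split.
  have h1 := integrable_step_inv r x0.
  by apply: eq_integrable (integrableD _ h1 IH1).
by rewrite RintegralD// ?Rintegral_step_inv// ?IH2//; exact: integrable_step_inv.
Qed.

End LogIntegral.

(** * Entire functions *)

Section EntireFunctions.
Variables (R : realType) (K : closedFieldType) (abs : K -> R).
Hypothesis absP : is_na_abs abs.
Hypothesis absC : abs_complete abs.
Hypothesis char0 : [pchar K] =i pred0.
Local Notation ent := (is_entire abs).
Local Notation mu := (mu_ent abs).
Local Notation ev := (ent_eval abs).
Implicit Types (a b u : nat -> K) (r : R) (z w : K) (F G : K -> K).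

Definition entire_fun F := exists2 a, ent a & F = ev a.

(** The norm is attached to the function, not to the series, so that products and compositions are
    ordinary expressions in [z]; the identity theorem makes the chosen series unique. *)
Definition gauss_norm F r :=
  mu (xget (fun=> 0) [set a | ent a /\ F = ev a]%classic) r.
Local Notation nrm := gauss_norm.

Lemma eval_inj a b : ent a -> ent b -> ev a = ev b -> a = b.
Proof.
move=> ea eb h; have h0 : (fun n => a n - b n) = fun=> 0.
  apply: (eval_eq0 absP absC char0 (entire_sub absP ea eb)) => z.
  by rewrite (evalB absP absC)// h subrr.
by apply/funext => n; apply/eqP; rewrite -subr_eq0; apply/eqP; exact: (congr1 (@^~ n) h0).
Qed.

Lemma gauss_norm_eval a r : ent a -> nrm (ev a) r = mu a r.
Proof.
move=> ea; rewrite /gauss_norm; congr mu_ent.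
case: xgetP => [b _ [eb h]|/(_ a)]; last by case.
exact: eval_inj.
Qed.

Lemma entire_fun_eval a : ent a -> entire_fun (ev a). Proof. by exists a. Qed.

Lemma gauss_norm_ge0 F r : entire_fun F -> 0 < r -> 0 <= nrm F r.
Proof. by move=> [a ea ->] r0; rewrite gauss_norm_eval// (mu_ge0 absP). Qed.

Lemma gauss_norm_gt0 F r z : entire_fun F -> 0 < r -> F z != 0 -> 0 < nrm F r.
Proof.
move=> [a ea ->] r0 h; rewrite gauss_norm_eval// lt_def (mu_ge0 absP)// andbT.
by apply: contraNneq h => /(mu_eq0 absP ea r0) ->; rewrite (eval0 absP).
Qed.

Lemma gauss_norm_le F s r : entire_fun F -> 0 < s -> s <= r -> nrm F s <= nrm F r.
Proof. by move=> [a ea ->] s0 sr; rewrite !gauss_norm_eval// (mu_mono absP). Qed.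

Lemma entire_fun_mul F G : entire_fun F -> entire_fun G -> entire_fun (fun z => F z * G z).
Proof.
move=> [a ea ->] [b eb ->]; exists (ps_mul a b); first exact: (entire_mul absP).
by apply/funext => z; rewrite (evalM absP absC).
Qed.

Lemma gauss_normM F G r : entire_fun F -> entire_fun G -> 0 < r ->
  nrm (fun z => F z * G z) r = nrm F r * nrm G r.
Proof.
move=> [a ea ->] [b eb ->] r0; rewrite !gauss_norm_eval// -(mu_mul absP)//.
rewrite -gauss_norm_eval; last exact: (entire_mul absP).
by congr gauss_norm; apply/funext => z; rewrite (evalM absP absC).
Qed.

Lemma entire_fun_sub F G : entire_fun F -> entire_fun G -> entire_fun (fun z => F z - G z).
Proof.
move=> [a ea ->] [b eb ->]; exists (fun n => a n - b n); first exact: (entire_sub absP).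
by apply/funext => z; rewrite (evalB absP absC).
Qed.

Lemma gauss_normB F G r : entire_fun F -> entire_fun G -> 0 < r ->
  nrm (fun z => F z - G z) r <= Num.max (nrm F r) (nrm G r).
Proof.
move=> [a ea ->] [b eb ->] r0; rewrite !gauss_norm_eval//.
apply: le_trans (mu_sub absP ea eb r0); rewrite -gauss_norm_eval; last exact: (entire_sub absP).
rewrite le_eqVlt; apply/orP; left; apply/eqP.
by congr gauss_norm; apply/funext => z; rewrite (evalB absP absC).
Qed.

Lemma entire_fun_cst (x : K) : entire_fun (fun=> x).
Proof.
exists (fun n => (x%:P)`_n); first exact: (entire_poly absP).
by apply/funext => z; rewrite (eval_poly absP) hornerC.
Qed.

Lemma gauss_norm_cst (x : K) r : 0 < r -> nrm (fun=> x) r = abs x.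
Proof.
move=> r0.
have -> : (fun=> x) = ev (fun n => (x%:P)`_n).
  by apply/funext => z; rewrite (eval_poly absP) hornerC.
rewrite gauss_norm_eval; last exact: (entire_poly absP).
apply/eqP; rewrite eq_le; apply/andP; split.
  apply: mu_le => -[|n]; rewrite coefC/= ?expr0 ?mulr1// (abs0 absP) mul0r.
  exact: (abs_ge0 absP).
apply: le_trans (mu_ub absP 0 (entire_poly absP _) r0).
by rewrite coefC expr0 mulr1.
Qed.

Lemma entire_fun_lin w : entire_fun (fun z => z - w).
Proof.
exists (lin w); first exact: (entire_lin absP).
by apply/funext => z; rewrite (eval_lin absP).
Qed.

Lemma gauss_norm_lin w r : 0 < r -> nrm (fun z => z - w) r = Num.max r (abs w).
Proof.
move=> r0; rewrite -(mu_lin absP)// -gauss_norm_eval; last exact: (entire_lin absP).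
by congr gauss_norm; apply/funext => z; rewrite (eval_lin absP).
Qed.

Lemma gauss_norm_distC F G r : entire_fun F -> entire_fun G -> 0 < r ->
  nrm (fun z => F z - G z) r = nrm (fun z => G z - F z) r.
Proof.
move=> eF eG r0; have eB := entire_fun_sub eG eF.
have -> : (fun z => F z - G z) = (fun z => -1 * (G z - F z)).
  by apply/funext => z; rewrite mulN1r opprB.
rewrite (gauss_normM (entire_fun_cst (-1)) eB r0) gauss_norm_cst//.
by rewrite (absN absP) (abs1 absP) mul1r.
Qed.

Lemma entire_fun_prod (I : Type) (s : seq I) (P : pred I) (F : I -> K -> K) :
  (forall i, P i -> entire_fun (F i)) ->
  entire_fun (fun z => \prod_(i <- s | P i) F i z).
Proof.
move=> h; elim: s => [|i s IH].
  rewrite (_ : (fun _ => _) = fun=> 1); first exact: entire_fun_cst.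
  by apply/funext => z; rewrite big_nil.
under eq_fun do rewrite big_cons.
by case: (boolP (P i)) => Pi //; apply: entire_fun_mul => //; exact: h.
Qed.

Lemma gauss_norm_prod (I : Type) (s : seq I) (P : pred I) (F : I -> K -> K) r :
  (forall i, P i -> entire_fun (F i)) -> 0 < r ->
  nrm (fun z => \prod_(i <- s | P i) F i z) r = \prod_(i <- s | P i) nrm (F i) r.
Proof.
move=> h r0; elim: s => [|i s IH].
  rewrite (_ : (fun _ => _) = fun=> 1) ?gauss_norm_cst ?(abs1 absP) ?big_nil//.
  by apply/funext => z; rewrite big_nil.
under eq_fun do rewrite big_cons.
rewrite big_cons; case: (boolP (P i)) => Pi //; rewrite gauss_normM ?IH//; first exact: h.
exact: entire_fun_prod.
Qed.

Lemma entire_fun_exp F n : entire_fun F -> entire_fun (fun z => F z ^+ n).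
Proof.
move=> eF; elim: n => [|n IH].
  by under eq_fun do rewrite expr0; exact: entire_fun_cst.
by under eq_fun do rewrite exprS; exact: entire_fun_mul.
Qed.

Lemma gauss_normX F n r : entire_fun F -> 0 < r ->
  nrm (fun z => F z ^+ n) r = nrm F r ^+ n.
Proof.
move=> eF r0; elim: n => [|n IH].
  by under eq_fun do rewrite expr0; rewrite gauss_norm_cst// (abs1 absP).
under eq_fun do rewrite exprS.
by rewrite gauss_normM ?IH ?exprS//; exact: entire_fun_exp.
Qed.

Lemma entire_fun_add F G : entire_fun F -> entire_fun G -> entire_fun (fun z => F z + G z).
Proof.
move=> eF eG; have := entire_fun_sub eF (entire_fun_sub (entire_fun_cst 0) eG).
by under eq_fun do rewrite sub0r opprK.
Qed.

Lemma gauss_normD_le F G r M : entire_fun F -> entire_fun G -> 0 < r ->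
  nrm F r <= M -> nrm G r <= M -> nrm (fun z => F z + G z) r <= M.
Proof.
move=> eF eG r0 hF hG.
have e0 := entire_fun_cst 0; have eN := entire_fun_sub e0 eG.
have -> : (fun z => F z + G z) = (fun z => F z - (0 - G z)).
  by apply/funext => z; rewrite sub0r opprK.
apply: le_trans (gauss_normB eF eN r0) _; rewrite ge_max hF/=.
apply: le_trans (gauss_normB e0 eG r0) _; rewrite ge_max hG gauss_norm_cst// (abs0 absP) andbT.
exact: le_trans (gauss_norm_ge0 eF r0) hF.
Qed.

Lemma entire_fun_sum (I : Type) (s : seq I) (F : I -> K -> K) :
  (forall i, entire_fun (F i)) -> entire_fun (fun z => \sum_(i <- s) F i z).
Proof.
move=> h; elim: s => [|i s IH].
  by under eq_fun do rewrite big_nil; exact: entire_fun_cst.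
by under eq_fun do rewrite big_cons; exact: entire_fun_add.
Qed.

Lemma gauss_norm_sum_le (I : eqType) (s : seq I) (F : I -> K -> K) r M :
  (forall i, entire_fun (F i)) -> 0 < r -> 0 <= M ->
  (forall i, i \in s -> nrm (F i) r <= M) ->
  nrm (fun z => \sum_(i <- s) F i z) r <= M.
Proof.
move=> h r0 M0; elim: s => [|i s IH] hM.
  by under eq_fun do rewrite big_nil; rewrite gauss_norm_cst// (abs0 absP).
under eq_fun do rewrite big_cons.
apply: gauss_normD_le => //; first exact: entire_fun_sum.
  by apply: hM; rewrite mem_head.
by apply: IH => j js; apply: hM; rewrite inE js orbT.
Qed.

Lemma entire_fun_affine F (al be : K) : abs al = 1 -> entire_fun F ->
  entire_fun (fun z => F (al * z + be)).
Proof.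
move=> al1 [a ea ->]; exists (affcomp abs al be a); first exact: entire_affcomp.
by apply/funext => z; rewrite eval_affcomp.
Qed.

(** The inequality [le] applied to the map and to its inverse gives equality: the inverse again has
    multiplier of absolute value 1 and translation of absolute value [abs be]. *)
Lemma gauss_norm_affine F (al be : K) r : abs al = 1 -> entire_fun F -> 0 < r ->
  abs be <= r -> nrm (fun z => F (al * z + be)) r = nrm F r.
Proof.
have le (x y : K) G : abs x = 1 -> entire_fun G -> 0 < r ->
    abs y <= r -> nrm (fun z => G (x * z + y)) r <= nrm G r.
  move=> x1 [a ea ->] r0 yr; rewrite gauss_norm_eval//.
  apply: le_trans (mu_affcomp_le absP absC x1 ea r0 yr).
  rewrite -gauss_norm_eval; last exact: entire_affcomp.
  rewrite le_eqVlt; apply/orP; left; apply/eqP.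
  by congr gauss_norm; apply/funext => z; rewrite eval_affcomp.
move=> al1 eF r0 br; apply/eqP; rewrite eq_le le//=.
have al0 : al != 0 by rewrite -(abs_eq0 absP) al1 oner_eq0.
have := @le al^-1 (- (al^-1 * be)) (fun z => F (al * z + be)).
rewrite (absN absP) (absM absP) (absV absP) al1 invr1 mul1r => /(_ erefl _ r0 br).
have -> : (fun z => F (al * (al^-1 * z - al^-1 * be) + be)) = F.
  by apply/funext => z; congr F; rewrite mulrBr !mulVKf// subrK.
by apply; exact: entire_fun_affine.
Qed.

(** Norms of non-zero factors are positive and multiply. This extends an identity across the zeros
    of a denominator. *)
Lemma entire_fun_eq0 F G : entire_fun F -> entire_fun G ->
  (forall z, F z * G z = 0) -> (exists z, G z != 0) -> forall z, F z = 0.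
Proof.
move=> eF eG h [w Gw] z; apply: contrapT => /eqP Fz.
have := mulr_gt0 (gauss_norm_gt0 eF ltr01 Fz) (gauss_norm_gt0 eG ltr01 Gw).
rewrite -gauss_normM//; under eq_fun do rewrite h.
by rewrite gauss_norm_cst// (abs0 absP) ltxx.
Qed.

Lemma entire_fun_divide F w : entire_fun F -> F w = 0 ->
  exists2 G, entire_fun G & F = fun z => (z - w) * G z.
Proof.
move=> [a ea ->] aw; have [b eb ->] := entire_divide absP absC ea aw.
exists (ev b); first exact: entire_fun_eval.
apply/funext => z; rewrite (evalM absP absC)// ?(eval_lin absP)//.
exact: (entire_lin absP).
Qed.

End EntireFunctions.

(** * Poles, the function N(r, f) and Jensen's inequality *)

Section Counting.
Variables (R : realType) (K : closedFieldType) (abs : K -> R).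
Hypothesis absP : is_na_abs abs.
Hypothesis absC : abs_complete abs.
Hypothesis char0 : [pchar K] =i pred0.
Local Notation ent := (is_entire abs).
Local Notation mu := (mu_ent abs).
Local Notation ev := (ent_eval abs).
Local Notation nrm := (gauss_norm abs).
Local Notation entire_fun := (entire_fun abs).
Implicit Types (a b u : nat -> K) (r : R) (z w : K) (F G : K -> K) (f : mero K).

(** The truncated difference of multiplicities is the one in [pole_mult]: with [s] the zeros of a
    numerator and [s'] those of a denominator, [s1'] lists the poles. *)
Lemma multiset_cancel (T : eqType) (s s' : seq T) : exists c s1 s1',
  [/\ perm_eq s (c ++ s1), perm_eq s' (c ++ s1') &
   forall x : T, count_mem x s1' = (count_mem x s' - count_mem x s)%N].
Proof.
elim: s s' => [|x s IH] s'.
  by exists [::], [::], s'; split=> // w; rewrite subn0.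
have [xs|xs] := boolP (x \in s').
  have [c [s1 [s1' [h1 h2 h3]]]] := IH (rem x s').
  exists (x :: c), s1, s1'; split; first by rewrite /= perm_cons.
    by apply: perm_trans (perm_to_rem xs) _; rewrite /= perm_cons.
  by move=> w; rewrite h3 (permP (perm_to_rem xs)) /= subnDl.
have [c [s1 [s1' [h1 h2 h3]]]] := IH s'.
exists c, (x :: s1), s1'; split => //.
  rewrite perm_sym; apply: perm_trans (_ : perm_eq (x :: (c ++ s1)) _).
    by rewrite -cat1s perm_catCA.
  by rewrite perm_cons perm_sym.
move=> w; rewrite h3 /=; have [<-|_] := eqVneq x w; last by rewrite add0n.
by rewrite (count_memPn xs) !sub0n.
Qed.

Lemma sum_count_undup (T : eqType) (s : seq T) (P : pred T) :
  (\sum_(x <- undup s | P x) count_mem x s)%N = count P s.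
Proof.
rewrite -sum1_count -[RHS]big_undup_iterop_count; apply: eq_bigr => w _.
by elim: (count_mem w s) => // -[|n] //= ->; rewrite add1n.
Qed.

Lemma npoles_count f r t (D : seq K) :
  (forall z, abs z <= r -> pole_mult abs f z = count_mem z D) -> t <= r ->
  npoles abs f t = (count (fun w => abs w <= t) D)%:R.
Proof.
move=> hD tr; rewrite /npoles; congr (_%:R).
rewrite (@fsbigE _ _ _ _ _ [seq w <- undup D | abs w <= t]).
- rewrite big_filter_cond -(sum_count_undup D (fun w => abs w <= t)).
  have e w : (abs w <= t) && (w \in [set z | abs z <= t]%classic) = (abs w <= t).
    by rewrite mem_setE; exact: andbb.
  rewrite (eq_bigl _ _ e); apply: eq_bigr => w wt; apply: hD; exact: le_trans tr.
- exact: filter_uniq (undup_uniq _).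
- by move=> w /=; rewrite mem_filter => /andP[].
- move=> w /= wt; rewrite mem_filter wt mem_undup /= => h.
  by rewrite hD ?(le_trans wt)//; apply/count_memPn.
Qed.

Lemma Ncount_sum f r (D : seq K) : 0 < r ->
  (forall z, abs z <= r -> pole_mult abs f z = count_mem z D) ->
  (forall w, w \in D -> abs w <= r) ->
  Ncount abs f r = \sum_(w <- D) (if w == 0 then ln r else ln (r / abs w)).
Proof.
move=> r0 hD Dr; rewrite /Ncount (npoles_count hD (ltW r0)).
have c0 : count (fun w => abs w <= 0) D = count (pred1 0) D.
  by apply: eq_count => w /=; rewrite -(abs_eq0 absP w) eq_le (abs_ge0 absP) andbT.
(* The integrand subtracts n(0, f), so the integral sees only the non-zero poles; those at the
   origin make up the term in [ln r]. *)
pose D' := [seq w <- D | w != 0].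
have -> : Rintegral (@lebesgue_measure R) `]0, r]%classic
    (fun t => (npoles abs f t - (count (fun w => abs w <= 0) D)%:R) / t) =
    Rintegral (@lebesgue_measure R) `]0, r]%classic
    (fun t => (count (fun x => x <= t) (map abs D'))%:R / t).
  apply: eq_Rintegral => t; rewrite inE /= in_itv /= => /andP[t0 tr].
  rewrite (npoles_count hD tr); congr (_ / _).
  suff -> : count (fun w => (abs w <= t)%R) D =
      (count (fun x => (x <= t)%R) (map abs D') + count (fun w => (abs w <= 0)%R) D)%N.
    by rewrite natrD addrK.
  rewrite c0 count_map /D' count_filter; elim: (D) => //= w s ->.
  have [->|w0] := eqVneq w 0; first by rewrite (abs0 absP) (ltW t0) /=; lia.
  by rewrite andbT; lia.
have [|_ ->] := @Rintegral_count R (map abs D') r.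
  move=> _ /mapP[w + ->]; rewrite mem_filter => /andP[w0 wD].
  by rewrite (abs_gt0 absP) w0 Dr.
rewrite c0 big_map /D' big_filter [RHS](bigID (fun w => w == 0)) /= addrC; congr (_ + _).
  by apply: eq_bigr => w /negPf ->.
rewrite [RHS](eq_bigr (fun=> ln r)); last by move=> w ->.
by rewrite big_const_seq iter_addr_0 mulr_natl; congr (_ *+ _); exact: eq_count.
Qed.

(** A pole [w != 0] contributes [ln r - ln (max r0 (abs w))] to the growth and [ln r - ln (abs w)]
    to N. At the origin the comparison is [ln r - ln r0 <= ln r], whence [1 <= r0]. *)
Lemma growth_le_Ncount f r r0 (D : seq K) : 1 <= r0 -> r0 <= r ->
  (forall z, abs z <= r -> pole_mult abs f z = count_mem z D) ->
  (forall w, w \in D -> abs w <= r) ->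
  ln (\prod_(w <- D) Num.max r (abs w)) <=
    ln (\prod_(w <- D) Num.max r0 (abs w)) + Ncount abs f r.
Proof.
move=> r01 r0r hD Dr.
have r0_gt0 : 0 < r0 := lt_le_trans ltr01 r01.
have r_gt0 : 0 < r := lt_le_trans r0_gt0 r0r.
rewrite (Ncount_sum r_gt0 hD Dr); move: Dr {hD}; elim: D => [|w D IH] hD.
  by rewrite !big_nil ln1 addr0.
have {}IH := IH (fun v vD => hD v (@mem_behead _ (w :: D) v vD)).
have pos s (E : seq K) : 0 < s -> 0 < \prod_(w <- E) Num.max s (abs w).
  by move=> s0; apply: prodr_gt0 => v _; rewrite lt_max s0.
have pos1 s : 0 < s -> 0 < Num.max s (abs w) by move=> s0; rewrite lt_max s0.
have lnE s : 0 < s -> ln (Num.max s (abs w) * \prod_(v <- D) Num.max s (abs v)) =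
    ln (Num.max s (abs w)) + ln (\prod_(v <- D) Num.max s (abs v)).
  by move=> s0; rewrite lnM ?posrE ?pos ?pos1.
rewrite !big_cons !lnE// addrACA lerD// (max_idPl (hD w (mem_head _ _))).
have [->|w0] := eqVneq w 0.
  by rewrite (abs0 absP) lerDr (max_idPl (ltW r0_gt0)) ln_ge0.
have aw : 0 < abs w by rewrite (abs_gt0 absP).
rewrite ln_div ?posrE// addrCA lerDl subr_ge0 ler_ln ?posrE ?pos1//.
by rewrite le_max lexx orbT.
Qed.

Lemma taylor_coef_zero z k : taylor_coef abs (fun=> 0) z k = 0.
Proof.
rewrite /taylor_coef -[RHS](eval0 absP absC z); congr ent_eval.
by apply/funext => n; rewrite mul0r.
Qed.

Lemma entire_zeros a r : ent a -> 0 < r -> (exists n, a n != 0) ->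
  exists s U k, [/\ entire_fun U, ev a = (fun z => \prod_(w <- s) (z - w) * U z),
    (forall z, abs z <= r -> (exists j, taylor_coef abs a z j != 0) /\
       ent_ord abs a z = count_mem z s),
    (forall w, w \in s -> abs w <= r) &
    0 < k /\ forall t, 0 < t -> t <= r -> nrm U t = k].
Proof.
move=> ea r0 [n an]; have [k hk] := maxidx_exists absP ea r0 an.
have [s [u [-> eu hu hs]]] := entire_factor absP absC ea r0 hk.
exists s, (ev u), (abs (u 0%N)); split=> //.
- exact: entire_fun_eval.
- by apply/funext => z; rewrite (eval_linprod absP absC).
- move=> z zr; have uz := maxidx0_neq0 absP absC eu r0 hu zr; split.
    by exists (count_mem z s); have [] := taylor_coef_linprod absP absC s eu uz.
  by rewrite (ent_ord_linprod absP absC).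
- split; first by rewrite (abs_gt0 absP) (maxidx_neq0 absP r0 hu).
  move=> t t0 tr; rewrite (gauss_norm_eval absP absC char0)//.
  exact: (mu_maxidx0 absP t0 tr hu).
Qed.

Lemma entire_fun_prod_lin (s : seq K) : entire_fun (fun z => \prod_(w <- s) (z - w)).
Proof. by apply: (entire_fun_prod absP absC) => w _; exact: (entire_fun_lin absP). Qed.

Lemma gauss_norm_prod_lin (s : seq K) r : 0 < r ->
  nrm (fun z => \prod_(w <- s) (z - w)) r = \prod_(w <- s) Num.max r (abs w).
Proof.
move=> r0; rewrite (gauss_norm_prod absP absC char0)//; last first.
  by move=> w _; exact: (entire_fun_lin absP).
by apply: eq_bigr => w _; rewrite (gauss_norm_lin absP absC char0).
Qed.

(* Cancelling the common zeros of numerator and denominator in |z| <= r turns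
   the zeros of the denominator into the poles counted by N(r,f). *)
Lemma mero_reduce_poles f r : is_mero abs f -> 0 < r ->
  exists t g h D k, [/\ [/\ entire_fun t, entire_fun g, entire_fun h,
     ev (Defs.num f) = (fun z => t z * g z) & ev (den f) = (fun z => t z * h z)],
     (forall z, abs z <= r -> pole_mult abs f z = count_mem z D),
     (forall w, w \in D -> abs w <= r), 0 < k &
     forall s, 0 < s -> s <= r -> nrm h s = \prod_(w <- D) Num.max s (abs w) * k].
Proof.
move=> [ea [eb hb]] r0.
have [a0|ha] := seq_eq0P (Defs.num f).
  (* By convention the zero function has no poles whatever its denominator, so the whole denominator
     is cancelled. *)
  exists (ev (den f)), (fun=> 0), (fun=> 1), [::], 1; split=> //.
  - split=> //; last by apply/funext => z; rewrite mulr1.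
    + exact: entire_fun_eval.
    + exact: (entire_fun_cst absP).
    + exact: (entire_fun_cst absP).
    + by apply/funext => z; rewrite mulr0 a0 (eval0 absP absC).
  - move=> z _; rewrite /pole_mult ifF//; apply/negbTE/asboolPn => -[k].
    by rewrite a0 taylor_coef_zero eqxx.
  - move=> s s0 _; rewrite big_nil mul1r (gauss_norm_cst absP absC char0)//.
    exact: (abs1 absP).
have [sa [U [ka [eU Ua orda sar [ka0 hU]]]]] := entire_zeros ea r0 ha.
have [sb [V [kb [eV Vb ordb sbr [kb0 hV]]]]] := entire_zeros eb r0 hb.
have [c [s1 [D [h1 h2 h3]]]] := multiset_cancel sa sb.
exists (fun z => \prod_(w <- c) (z - w)), (fun z => \prod_(w <- s1) (z - w) * U z),
  (fun z => \prod_(w <- D) (z - w) * V z), D, kb; split=> //.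
- split.
  + exact: entire_fun_prod_lin.
  + by apply: (entire_fun_mul absP absC) => //; exact: entire_fun_prod_lin.
  + by apply: (entire_fun_mul absP absC) => //; exact: entire_fun_prod_lin.
  + by rewrite Ua; apply/funext => z; rewrite (perm_big _ h1) big_cat mulrA.
  + by rewrite Vb; apply/funext => z; rewrite (perm_big _ h2) big_cat mulrA.
- move=> z zr; have [ex orda_z] := orda z zr; have [_ ordb_z] := ordb z zr.
  by rewrite /pole_mult ifT ?orda_z ?ordb_z ?h3//; apply/asboolP.
- by move=> w wD; apply: sbr; rewrite (perm_mem h2) mem_cat wD orbT.
- move=> s s0 sr; rewrite (gauss_normM absP absC char0)//; last exact: entire_fun_prod_lin.
  by rewrite gauss_norm_prod_lin// hV.
Qed.

(** The larger of the two norms is [nrm h r] times the maximum of 1 and [mu_mero abs f r]; its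
    logarithm is m(r, f) plus [ln (nrm h r)], which exceeds [ln (nrm h r0)] by at most N(r, f). *)
Lemma mero_reduce f r : is_mero abs f -> 1 <= r ->
  exists t g h, [/\ entire_fun t, entire_fun g, entire_fun h,
     ev (Defs.num f) = (fun z => t z * g z) & ev (den f) = (fun z => t z * h z)] /\
  forall r0, 1 <= r0 -> r0 <= r ->
    ln (Num.max (nrm g r) (nrm h r)) <= Tchar abs f r + ln (nrm h r0).
Proof.
move=> mf r1; have r_gt0 : 0 < r := lt_le_trans ltr01 r1.
have [t [g [h [D [k [[et eg eh Eg Eh] hD Dr k0 nh]]]]]] := mero_reduce_poles mf r_gt0.
exists t, g, h; split=> // r0 r01 r0r.
have r0_gt0 : 0 < r0 := lt_le_trans ltr01 r01.
have pos s : 0 < s -> 0 < \prod_(w <- D) Num.max s (abs w).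
  by move=> s0; apply: prodr_gt0 => v _; rewrite lt_max s0.
have hN : ln (nrm h r) <= ln (nrm h r0) + Ncount abs f r.
  rewrite !nh// !lnM ?posrE ?pos// addrAC lerD2r.
  exact: growth_le_Ncount.
have hr : 0 < nrm h r by rewrite nh// mulr_gt0// pos.
have [ea [eb hb]] := mf.
have [z dz] : exists z, ev (den f) z != 0.
  have [n bn] := hb; apply: contrapT => /forallNP hz.
  have b0 := eval_eq0 absP absC char0 eb (fun z => contrapT (fun H => hz z (introN eqP H))).
  by move: bn; rewrite b0 eqxx.
have tr : 0 < nrm t r.
  apply: (gauss_norm_gt0 absP absC char0 (z := z)) => //; move: dz; rewrite Eh.
  by apply: contraNneq => ->; rewrite mul0r.
have muE : mu_mero abs f r = nrm g r / nrm h r.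
  rewrite /mu_mero -!(gauss_norm_eval absP absC char0)// Eg Eh.
  by rewrite !(gauss_normM absP absC char0)// -mulf_div divff ?gt_eqF// mul1r.
rewrite /Tchar -addrA [Ncount _ _ _ + _]addrC.
suff le : ln (Num.max (nrm g r) (nrm h r)) <= mprox abs f r + ln (nrm h r).
  by apply: le_trans le _; rewrite lerD2l.
rewrite /mprox muE; case: (leP (nrm g r) (nrm h r)) => gh.
  by rewrite lerDr le_max lexx.
by rewrite -lerBlDr le_max ln_div ?posrE ?lexx ?orbT// (lt_trans hr).
Qed.

End Counting.

(** * Differences of products in Gauss norm *)

Section GaussNormClose.
Variables (R : realType) (K : closedFieldType) (abs : K -> R).
Hypothesis absP : is_na_abs abs.
Hypothesis absC : abs_complete abs.
Hypothesis char0 : [pchar K] =i pred0.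
Local Notation nrm := (gauss_norm abs).
Local Notation entire_fun := (entire_fun abs).
Implicit Types (F G : K -> K).
Variables (r M dl : R).
Hypotheses (r0 : 0 < r) (M0 : 0 <= M) (dl0 : 0 <= dl).

(** A product of [m] factors of norm at most [M], each changed by at most [dl], changes by at most
    [M ^+ (m - 1) * dl]. Multiplying through by [M] keeps the empty product [m = 0] in the same
    format. *)
Definition gauss_close F G m := [/\ entire_fun F, entire_fun G,
  nrm F r <= M ^+ m, nrm G r <= M ^+ m &
  nrm (fun z => F z - G z) r * M <= M ^+ m * dl].

Lemma gauss_close1 : gauss_close (fun=> 1) (fun=> 1) 0.
Proof.
have e1 := entire_fun_cst absP 1.
split=> //; rewrite ?(gauss_norm_cst absP absC char0)// ?(abs1 absP)//.
by rewrite subrr (abs0 absP) mul0r expr0 mul1r.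
Qed.

Lemma gauss_closeM F G F' G' m m' : gauss_close F G m -> gauss_close F' G' m' ->
  gauss_close (fun z => F z * F' z) (fun z => G z * G' z) (m + m').
Proof.
move=> [eF eG hF hG h] [eF' eG' hF' hG' h'].
have [eB eB'] := (entire_fun_sub absP absC eF eG, entire_fun_sub absP absC eF' eG').
have ge0 H : entire_fun H -> 0 <= nrm H r.
  by move=> eH; exact: (gauss_norm_ge0 absP absC char0).
split; try exact: (entire_fun_mul absP absC).
- by rewrite (gauss_normM absP absC char0)// exprD ler_pM// ge0.
- by rewrite (gauss_normM absP absC char0)// exprD ler_pM// ge0.
have -> : (fun z => F z * F' z - G z * G' z) =
    (fun z => F z * (F' z - G' z) + (F z - G z) * G' z).
  by apply/funext => z; ring.
have [eX eY] := (entire_fun_mul absP absC eF eB', entire_fun_mul absP absC eB eG').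
have [->|M_neq0] := eqVneq M 0.
  by rewrite mulr0 mulr_ge0// exprn_ge0.
have M_gt0 : 0 < M by rewrite lt_def M_neq0.
rewrite -ler_pdivlMr//; apply: (gauss_normD_le absP absC char0) => //; rewrite ler_pdivlMr//.
  rewrite (gauss_normM absP absC char0)// -mulrA exprD -mulrA ler_pM ?ge0//.
  by rewrite mulr_ge0// ge0.
rewrite (gauss_normM absP absC char0)// mulrAC exprD [leRHS]mulrAC ler_pM ?ge0//.
by rewrite mulr_ge0// ge0.
Qed.

Lemma gauss_closeX F G m k : gauss_close F G m ->
  gauss_close (fun z => F z ^+ k) (fun z => G z ^+ k) (m * k).
Proof.
move=> h; elim: k => [|k IH].
  by rewrite muln0; under eq_fun do rewrite expr0; exact: gauss_close1.
under eq_fun do rewrite exprS; under [X in gauss_close _ X]eq_fun do rewrite exprS.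
by rewrite mulnS; exact: gauss_closeM.
Qed.

Lemma gauss_close_prod (J : Type) (s : seq J) (F G : J -> K -> K) (m : nat) :
  (forall j, gauss_close (F j) (G j) m) ->
  gauss_close (fun z => \prod_(j <- s) F j z) (fun z => \prod_(j <- s) G j z) (m * size s).
Proof.
move=> h; elim: s => [|j s IH].
  rewrite muln0; under eq_fun do rewrite big_nil.
  by under [X in gauss_close _ X]eq_fun do rewrite big_nil; exact: gauss_close1.
under eq_fun do rewrite big_cons; under [X in gauss_close _ X]eq_fun do rewrite big_cons.
by rewrite /= mulnS; exact: gauss_closeM.
Qed.

End GaussNormClose.

(** * The equation with cleared denominators *)

Section ClearedEquation.
Variables (R : realType) (K : closedFieldType) (abs : K -> R).
Hypothesis absP : is_na_abs abs.
Hypothesis absC : abs_complete abs.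
Hypothesis char0 : [pchar K] =i pred0.
Local Notation nrm := (gauss_norm abs).
Local Notation entire_fun := (entire_fun abs).
Variables (n : nat) (al be : 'I_n.+1 -> K) (I : seq (n.+1.-tuple nat)) (d : nat).
Local Notation idx := (n.+1.-tuple nat).
Local Notation L j z := (al j * z + be j).
Hypothesis uI : uniq I.
Hypothesis degI : forall i, i \in I -> forall j, (tnth i j <= d)%N.
Implicit Types (cn cd tc : idx -> K -> K) (u v g h : K -> K) (i : idx) (z : K).

Definition coef_clear cn cd i z := cn i z * \prod_(k <- I | k != i) cd k z.

(** Each shifted variable is homogenised separately to degree [d], so that a common factor of [u]
    and [v] leaves all monomials with the same power. *)
Definition mono_clear u v i z :=
  \prod_(j < n.+1) (u (L j z) ^+ tnth i j * v (L j z) ^+ (d - tnth i j)).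

Definition Omega_clear cn cd u v z :=
  \sum_(i <- I) coef_clear cn cd i z * mono_clear u v i z.

(** Homogeneity of the cleared equation, in the coefficients and in the unknown. It serves both to
    clear denominators and to follow the cancellation of common factors. *)
Lemma Omega_clear_scale cn cd u v tc t cn' cd' u' v' z :
  (forall i, i \in I -> cn' i z = tc i z * cn i z /\ cd' i z = tc i z * cd i z) ->
  (forall j, u' (L j z) = t (L j z) * u (L j z) /\ v' (L j z) = t (L j z) * v (L j z)) ->
  Omega_clear cn' cd' u' v' z =
    (\prod_(i <- I) tc i z * \prod_(j < n.+1) t (L j z) ^+ d) * Omega_clear cn cd u v z.
Proof.
move=> hc hu; rewrite /Omega_clear mulr_sumr; apply: eq_big_seq => i iI.
rewrite mulrACA; congr (_ * _).
  rewrite /coef_clear (hc i iI).1 (bigD1_seq i)//= mulrACA; congr (_ * _).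
  rewrite -big_split [LHS]big_seq_cond [RHS]big_seq_cond; apply: eq_bigr => k /andP[kI _].
  exact: (hc k kI).2.
rewrite /mono_clear -big_split; apply: eq_bigr => j _ /=.
by rewrite (hu j).1 (hu j).2 !exprMn -{3}(subnKC (degI iI j)) exprD; ring.
Qed.

Lemma Omega_clear_eval cn cd u v z :
  (forall i, i \in I -> cd i z != 0) -> (forall j, v (L j z) != 0) ->
  Omega_clear cn cd u v z =
    (\prod_(i <- I) cd i z * \prod_(j < n.+1) v (L j z) ^+ d) *
    \sum_(i <- I) (cn i z / cd i z * \prod_(j < n.+1) (u (L j z) / v (L j z)) ^+ tnth i j).
Proof.
move=> hc hv.
(* Start from the fractions over denominator 1 and scale by [cd] and [v]. *)
rewrite (@Omega_clear_scale (fun i z => cn i z / cd i z) (fun _ _ => 1)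
  (fun z => u z / v z) (fun=> 1) cd v); last 2 first.
- by move=> i iI; split; rewrite /= ?mulr1 // [RHS]mulrC divfK ?hc.
- by move=> j; split; rewrite /= ?mulr1 // [RHS]mulrC divfK ?hv.
congr (_ * _); apply: eq_bigr => i _; rewrite /coef_clear /mono_clear big1// mulr1.
by congr (_ * _); apply: eq_bigr => j _; rewrite expr1n mulr1.
Qed.

Hypothesis al1 : forall j, abs (al j) = 1.

Lemma entire_coef_clear cn cd i : (forall i, entire_fun (cn i)) ->
  (forall i, entire_fun (cd i)) -> entire_fun (coef_clear cn cd i).
Proof.
move=> en ed; apply: (entire_fun_mul absP absC) => //.
by apply: (entire_fun_prod absP absC).
Qed.

Lemma entire_mono_clear u v i : entire_fun u -> entire_fun v ->
  entire_fun (mono_clear u v i).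
Proof.
move=> eu ev; apply: (entire_fun_prod absP absC) => j _.
by apply: (entire_fun_mul absP absC); apply: (entire_fun_exp absP absC);
  apply: (entire_fun_affine absP absC).
Qed.

Lemma entire_Omega_clear cn cd u v : (forall i, entire_fun (cn i)) ->
  (forall i, entire_fun (cd i)) -> entire_fun u -> entire_fun v ->
  entire_fun (Omega_clear cn cd u v).
Proof.
move=> en ed eu ev; apply: (entire_fun_sum absP absC) => i.
apply: (entire_fun_mul absP absC); first exact: entire_coef_clear.
exact: entire_mono_clear.
Qed.

Lemma gauss_norm_coef_clear cn cd i r : (forall i, entire_fun (cn i)) ->
  (forall i, entire_fun (cd i)) -> 0 < r -> i \in I ->
  nrm (coef_clear cn cd i) r <= \prod_(k <- I) Num.max (nrm (cn k) r) (nrm (cd k) r).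
Proof.
move=> en ed r0 iI; have ge0 G : entire_fun G -> 0 <= nrm G r.
  by move=> eG; exact: (gauss_norm_ge0 absP absC char0).
rewrite (gauss_normM absP absC char0)//; last by apply: (entire_fun_prod absP absC).
rewrite (gauss_norm_prod absP absC char0)// [leRHS](bigD1_seq i)//=.
apply: ler_pM; rewrite ?ge0 ?le_max ?lexx//.
  by apply: prodr_ge0 => k _; exact: ge0.
by apply: ler_prod => k _; rewrite ge0// le_max lexx orbT.
Qed.

Lemma gauss_norm_affine_prod t r : entire_fun t -> 0 < r ->
  (forall j, abs (be j) <= r) ->
  nrm (fun z => \prod_(j < n.+1) t (L j z) ^+ d) r = nrm t r ^+ (d * n.+1).
Proof.
move=> et r0 br; have eL j : entire_fun (fun z => t (L j z)).
  by apply: (entire_fun_affine absP absC).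
rewrite (gauss_norm_prod absP absC char0)//; last first.
  by move=> j _; apply: (entire_fun_exp absP absC).
under eq_bigr => j _ do rewrite (gauss_normX absP absC char0)// (gauss_norm_affine absP absC char0)//.
by rewrite big_const_ord iter_mulr_1 exprM.
Qed.

(* Subtracting the equation satisfied by g/h from the value at u/v, every
   monomial contributes a factor gv - uh, and composition with an affine map
   of multiplier of absolute value 1 leaves the Gauss norm unchanged. *)
Lemma gauss_norm_Omega_clear cn cd u v g h r :
  (forall i, entire_fun (cn i)) -> (forall i, entire_fun (cd i)) ->
  entire_fun u -> entire_fun v -> entire_fun g -> entire_fun h ->
  0 < r -> (forall j, abs (be j) <= r) ->
  0 < nrm v r -> 0 < nrm h r -> (forall z, Omega_clear cn cd g h z = 0) ->
  nrm (fun z => g z * v z - u z * h z) r <= nrm h r * nrm v r ->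
  nrm (Omega_clear cn cd u v) r * (nrm h r * nrm v r) <=
    \prod_(k <- I) Num.max (nrm (cn k) r) (nrm (cd k) r) *
    Num.max (nrm u r) (nrm v r) ^+ (d * n.+1) * nrm (fun z => g z * v z - u z * h z) r.
Proof.
move=> en ed eu ev eg eh r0 br v0 h0 Omega0 small.
have ge0 G : entire_fun G -> 0 <= nrm G r.
  by move=> eG; exact: (gauss_norm_ge0 absP absC char0).
set B := Num.max (nrm u r) (nrm v r); set dl := nrm (fun z => _) r in small *.
set Cm := \prod_(k <- I) _.
have eM F G : entire_fun F -> entire_fun G -> entire_fun (fun z => F z * G z).
  exact: (entire_fun_mul absP absC).
have nM F G : entire_fun F -> entire_fun G -> nrm (fun z => F z * G z) r = nrm F r * nrm G r.
  by move=> eF eG; exact: (gauss_normM absP absC char0).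
have B0 : 0 < B by rewrite lt_max v0 orbT.
have uB : nrm u r <= B by rewrite le_max lexx.
have vB : nrm v r <= B by rewrite le_max lexx orbT.
(* [M] bounds the norms of [u h], [v h] and [g v] alike; for [g v] this uses [small]. *)
pose M := nrm h r * B; have M0 : 0 < M by rewrite mulr_gt0.
have eD : entire_fun (fun z => g z * v z - u z * h z).
  by apply: (entire_fun_sub absP absC); exact: eM.
have dl0 : 0 <= dl by exact: ge0.
have Cm0 : 0 <= Cm by apply: prodr_ge0 => k _; rewrite le_max !ge0.
have nL F j : entire_fun F -> nrm (fun z => F (L j z)) r = nrm F r.
  by move=> eF; apply: (gauss_norm_affine absP absC char0).
have eL F j : entire_fun F -> entire_fun (fun z => F (L j z)).
  by move=> eF; apply: (entire_fun_affine absP absC).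
have gvM : nrm (fun z => g z * v z) r <= M.
  have -> : (fun z => g z * v z) = (fun z => (g z * v z - u z * h z) + u z * h z).
    by apply/funext => z; rewrite subrK.
  apply: (gauss_normD_le absP absC char0) => //; first exact: eM.
    by apply: (le_trans small); rewrite ler_wpM2l// ltW.
  by rewrite nM// mulrC ler_wpM2l// ltW.
have uhM : nrm (fun z => u z * h z) r <= M by rewrite nM// mulrC ler_wpM2l// ltW.
have vhM : nrm (fun z => v z * h z) r <= M by rewrite nM// mulrC ler_wpM2l// ltW.
have close1 j : gauss_close abs r M dl (fun z => u (L j z) * h (L j z))
    (fun z => g (L j z) * v (L j z)) 1.
  split; rewrite ?expr1.
  - exact: (eL (fun z => u z * h z) j (eM _ _ eu eh)).
  - exact: (eL (fun z => g z * v z) j (eM _ _ eg ev)).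
  - by rewrite (nL (fun z => u z * h z) j (eM _ _ eu eh)).
  - by rewrite (nL (fun z => g z * v z) j (eM _ _ eg ev)).
  - rewrite mulrC ler_wpM2l ?(ltW M0)//.
    rewrite (gauss_norm_distC absP absC char0) ?(nL _ j eD)//.
      exact: (eL (fun z => u z * h z) j (eM _ _ eu eh)).
    exact: (eL (fun z => g z * v z) j (eM _ _ eg ev)).
have close2 j : gauss_close abs r M dl (fun z => v (L j z) * h (L j z))
    (fun z => v (L j z) * h (L j z)) 1.
  have evh := eL (fun z => v z * h z) j (eM _ _ ev eh).
  split=> //; rewrite ?expr1 ?(nL (fun z => v z * h z) j (eM _ _ ev eh))//.
  under eq_fun do rewrite subrr.
  rewrite (gauss_norm_cst absP absC char0)// (abs0 absP) mul0r.
  by rewrite mulr_ge0// ltW.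
(* Over the common denominator [v h], the values [u / v] and [g / h] have numerators [u h] and
   [g v]; [A] and [B'] are the monomials in these. *)
pose A i z := \prod_(j < n.+1) ((u (L j z) * h (L j z)) ^+ tnth i j *
   (v (L j z) * h (L j z)) ^+ (d - tnth i j)).
pose B' i z := \prod_(j < n.+1) ((g (L j z) * v (L j z)) ^+ tnth i j *
   (v (L j z) * h (L j z)) ^+ (d - tnth i j)).
have closeAB i : i \in I -> gauss_close abs r M dl (A i) (B' i) (d * n.+1).
  move=> iI; rewrite -[X in (d * X)%N](card_ord n.+1) cardT enumT.
  apply: (gauss_close_prod absP absC char0) => // [|j]; first exact: ltW.
  have := gauss_closeM absP absC char0 r0 (ltW M0) dl0
    (gauss_closeX absP absC char0 r0 (ltW M0) dl0 (tnth i j) (close1 j))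
    (gauss_closeX absP absC char0 r0 (ltW M0) dl0 (d - tnth i j) (close2 j)).
  by rewrite !mul1n subnKC// degI.
pose H z := \prod_(j < n.+1) h (L j z) ^+ d.
have AE i z : i \in I -> A i z = H z * mono_clear u v i z.
  move=> iI; rewrite -big_split; apply: eq_bigr => j _ /=.
  by rewrite !exprMn -[X in _ = _ ^+ X * _](subnKC (degI iI j)) exprD; ring.
have BE i z : i \in I -> B' i z = (\prod_(j < n.+1) v (L j z) ^+ d) * mono_clear g h i z.
  move=> iI; rewrite -big_split; apply: eq_bigr => j _ /=.
  by rewrite !exprMn -[X in _ = _ ^+ X * _](subnKC (degI iI j)) exprD; ring.
(* The terms with [B'] add up to a multiple of the equation for [g / h], which vanishes. *)
have HP : (fun z => H z * Omega_clear cn cd u v z) =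
    (fun z => \sum_(i <- I) coef_clear cn cd i z * (A i z - B' i z)).
  apply/funext => z; apply/esym.
  rewrite (eq_big_seq (fun i => H z * (coef_clear cn cd i z * mono_clear u v i z) -
    (\prod_(j < n.+1) v (L j z) ^+ d) * (coef_clear cn cd i z * mono_clear g h i z))).
    by rewrite sumrB -!mulr_sumr -!/(Omega_clear _ _ _ _ _) Omega0 mulr0 subr0.
  by move=> i iI; rewrite AE// BE//; ring.
have eH : entire_fun H.
  by apply: (entire_fun_prod absP absC) => j _; apply: (entire_fun_exp absP absC); exact: eL.
have eP := entire_Omega_clear en ed eu ev.
pose N := (d * n.+1)%N.
have eAB i : entire_fun (fun z => A i z - B' i z).
  apply: (entire_fun_sub absP absC); apply: (entire_fun_prod absP absC) => j _;
    apply: (eM); apply: (entire_fun_exp absP absC).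
  - exact: (eL (fun z => u z * h z) j (eM _ _ eu eh)).
  - exact: (eL (fun z => v z * h z) j (eM _ _ ev eh)).
  - exact: (eL (fun z => g z * v z) j (eM _ _ eg ev)).
  - exact: (eL (fun z => v z * h z) j (eM _ _ ev eh)).
have key : nrm h r ^+ N * nrm (Omega_clear cn cd u v) r <= Cm * (M ^+ N * dl / M).
  rewrite -(gauss_norm_affine_prod eh r0 br) -/H -nM// HP.
  apply: (gauss_norm_sum_le absP absC char0) => //.
  - by move=> i; apply: eM => //; exact: entire_coef_clear.
  - by rewrite mulr_ge0// divr_ge0 ?(ltW M0)// mulr_ge0// exprn_ge0// ltW.
  - move=> i iI; rewrite nM//; last exact: entire_coef_clear.
    have [_ _ _ _ hAB] := closeAB i iI.
    apply: ler_pM; rewrite ?ge0//; first exact: entire_coef_clear.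
      exact: gauss_norm_coef_clear.
    by rewrite ler_pdivlMr.
have hN : 0 < nrm h r ^+ N by exact: exprn_gt0.
apply: (@le_trans _ _ (nrm (Omega_clear cn cd u v) r * M)).
  by rewrite ler_wpM2l ?ge0// ler_wpM2l// ltW.
rewrite -(ler_pM2l hN) mulrA -ler_pdivlMr//; apply: (le_trans key).
rewrite {1}/M exprMn le_eqVlt; apply/orP; left; apply/eqP; ring.
Qed.

End ClearedEquation.

(** * The proximity function *)

Section Proximity.
Variables (R : realType) (K : closedFieldType) (abs : K -> R).
Hypothesis absP : is_na_abs abs.
Hypothesis absC : abs_complete abs.
Hypothesis char0 : [pchar K] =i pred0.
Local Notation ev := (ent_eval abs).
Local Notation nrm := (gauss_norm abs).
Local Notation entire_fun := (entire_fun abs).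
Implicit Types (f a : mero K) (r : R) (z w : K).

Lemma mero_den_neq0 f : is_mero abs f -> exists z, ev (den f) z != 0.
Proof.
move=> [_ [eb [n bn]]]; apply: contrapT => /forallNP hz.
have b0 := eval_eq0 absP absC char0 eb (fun z => contrapT (fun H => hz z (introN eqP H))).
by move: bn; rewrite b0 eqxx.
Qed.

(** With [c] the value at [z0], the numerator of [f - c] vanishes at [z0] without being zero.
    Splitting off [z - z0] shows that its norm grows at least like [r], and T(r, f) controls that
    norm. *)
Lemma Tchar_ge_ln f : is_mero abs f -> mero_nonconst abs f ->
  exists C r0, forall r, r0 <= r -> ln r <= Tchar abs f r + C.
Proof.
move=> mf [z0 [w0 [dz0 [dw0 neq]]]]; have [ea [eb _]] := mf.
rewrite /mero_def in dz0 dw0; set c := mero_eval abs f z0.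
pose X z := ev (Defs.num f) z - c * ev (den f) z.
have X0 : X z0 = 0 by rewrite /X /c /mero_eval divfK// subrr.
have Xw : X w0 != 0.
  rewrite subr_eq0 -[X in _ != c * X](invrK (ev (den f) w0)); apply: contraNneq neq => h.
  by rewrite {2}/mero_eval h invrK mulfK.
have eX : entire_fun X.
  apply: (entire_fun_sub absP absC); first exact: entire_fun_eval.
  apply: (entire_fun_mul absP absC); [exact: (entire_fun_cst absP)|exact: entire_fun_eval].
pose r0 := 1 + abs z0; have r01 : 1 <= r0 by rewrite lerDl (abs_ge0 absP).
have r0_gt0 : 0 < r0 := lt_le_trans ltr01 r01.
have z0r0 : abs z0 <= r0 by rewrite lerDr.
pose B := Num.max 1 (abs c); have B0 : 0 < B by rewrite lt_max ltr01.
(* The reduced functions [h] and [X'] depend on [r], but their norms at [r0] have the same ratio as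
   those of [den f] and [X], so the constant does not. *)
exists (ln r0 + ln B + ln (nrm (ev (den f)) r0) - ln (nrm X r0)), r0 => r r0r.
have r_gt0 : 0 < r := lt_le_trans r0_gt0 r0r.
have [t [g [h [[et eg eh Eg Eh] hT]]]] := mero_reduce absP absC char0 mf (le_trans r01 r0r).
have {hT}T := hT r0 r01 r0r.
pose X' z := g z - c * h z.
have ech : entire_fun (fun z => c * h z).
  by apply: (entire_fun_mul absP absC) => //; exact: (entire_fun_cst absP).
have eX' : entire_fun X' by apply: (entire_fun_sub absP absC).
have XE : X = (fun z => t z * X' z).
  by apply/funext => z; rewrite /X Eg Eh /X'; ring.
have t0 : t z0 != 0 by move: dz0; rewrite Eh; apply: contraNneq => ->; rewrite mul0r.
have h0 : h z0 != 0 by move: dz0; rewrite Eh; apply: contraNneq => ->; rewrite mulr0.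
have X'0 : X' z0 = 0 by apply: (mulfI t0); rewrite mulr0 -[LHS](congr1 (@^~ z0) XE).
have X'w : X' w0 != 0 by move: Xw; rewrite XE; apply: contraNneq => ->; rewrite mulr0.
have [Y eY YE] := entire_fun_divide absP absC eX' X'0.
have Yw : Y w0 != 0 by move: X'w; rewrite YE; apply: contraNneq => ->; rewrite mulr0.
have pos F z s : entire_fun F -> F z != 0 -> 0 < s -> 0 < nrm F s.
  by move=> eF Fz s0; exact: (gauss_norm_gt0 absP absC char0 eF s0 Fz).
have nX' s : r0 <= s -> nrm X' s = s * nrm Y s.
  move=> r0s; have s0 := lt_le_trans r0_gt0 r0s.
  rewrite YE (gauss_normM absP absC char0 (entire_fun_lin absP z0) eY s0).
  by rewrite (gauss_norm_lin absP absC char0)// (max_idPl (le_trans z0r0 r0s)).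
have grow : ln r + ln (nrm X' r0) <= ln r0 + ln (nrm X' r).
  rewrite !nX'// !lnM ?posrE ?(pos _ _ _ eY Yw)// addrCA lerD2l lerD2l.
  by rewrite ler_ln ?posrE ?(pos _ _ _ eY Yw)// (gauss_norm_le absP absC char0).
have X'le : ln (nrm X' r) <= ln B + ln (Num.max (nrm g r) (nrm h r)).
  have m0 : 0 < Num.max (nrm g r) (nrm h r) by rewrite lt_max (pos _ _ _ eh h0) ?orbT.
  rewrite -lnM ?posrE// ler_ln ?posrE ?mulr_gt0 ?(pos _ _ _ eX' X'w)//.
  apply: (le_trans (gauss_normB absP absC char0 eg ech r_gt0)); rewrite ge_max.
  rewrite (gauss_normM absP absC char0 (entire_fun_cst absP c) eh r_gt0).
  rewrite (gauss_norm_cst absP absC char0)//; apply/andP; split.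
    rewrite -[X in X <= _]mul1r ler_pM ?ler01 ?le_max ?lexx//.
    exact: (gauss_norm_ge0 absP absC char0).
  rewrite ler_pM ?(abs_ge0 absP) ?(gauss_norm_ge0 absP absC char0)// le_max lexx orbT//.
rewrite XE Eh !(gauss_normM absP absC char0)// !lnM ?posrE;
  try by [exact: (pos _ _ _ et t0)|exact: (pos _ _ _ eh h0)|exact: (pos _ _ _ eX' X'w)].
lra.
Qed.

Lemma ln_prod_seq (T : eqType) (s : seq T) (F : T -> R) :
  (forall i, i \in s -> 0 < F i) -> ln (\prod_(i <- s) F i) = \sum_(i <- s) ln (F i).
Proof.
elim: s => [|i s IH] h; first by rewrite !big_nil ln1.
have hs j : j \in s -> 0 < F j by move=> js; apply: h; rewrite inE js orbT.
rewrite !big_cons lnM ?IH ?posrE ?h ?mem_head//.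
by rewrite big_seq; apply: prodr_gt0.
Qed.

Lemma mprox_inv_sub f a r : is_mero abs f -> is_mero abs a -> 0 < r ->
  let G z := ev (Defs.num f) z * ev (den a) z - ev (Defs.num a) z * ev (den f) z in
  mprox abs (mero_inv (mero_sub f a)) r =
    Num.max 0 (ln (nrm (ev (den f)) r * nrm (ev (den a)) r / nrm G r)).
Proof.
move=> [e1 [e2 _]] [e3 [e4 _]] r0 G.
have e14 := entire_mul absP e1 e4; have e32 := entire_mul absP e3 e2.
rewrite /mprox /mu_mero /mero_inv /mero_sub /= (mu_mul absP)//.
rewrite -!(gauss_norm_eval absP absC char0)//; last exact: (entire_sub absP).
congr (Num.max _ (ln (_ / nrm _ _))); apply/funext => z.
by rewrite (evalB absP absC)// !(evalM absP absC).
Qed.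

End Proximity.

(** * The bound for m(r, 1/(f-a)) *)

Section ProximityBound.
Variables (R : realType) (K : closedFieldType) (abs : K -> R).
Hypothesis absP : is_na_abs abs.
Hypothesis absC : abs_complete abs.
Hypothesis char0 : [pchar K] =i pred0.
Local Notation ev := (ent_eval abs).
Local Notation nrm := (gauss_norm abs).
Local Notation entire_fun := (entire_fun abs).
Variables (n : nat) (al be : 'I_n.+1 -> K) (I : seq (n.+1.-tuple nat)).
Variables (c : n.+1.-tuple nat -> mero K) (f a : mero K).
Hypothesis al1 : forall j, abs (al j) = 1.
Hypothesis uI : uniq I.
Hypothesis mc : forall i, i \in I -> is_mero abs (c i).
Hypothesis mf : is_mero abs f.
Hypothesis ma : is_mero abs a.
Hypothesis Omega_f : forall z, Omega_dom abs I c al be f z ->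
  Omega_at abs I c al be f z = 0.
Hypothesis Omega_a : exists z, Omega_dom abs I c al be a z /\
  Omega_at abs I c al be a z != 0.
Local Notation L j z := (al j * z + be j).

(** [C] has to precede [r], hence is written with the unreduced functions at [r0]. The factor [N] is
    [d * n.+1], the total degree after homogenising. *)
Lemma mprox_bound : exists N C r0, forall r, r0 <= r ->
  mprox abs (mero_inv (mero_sub f a)) r <=
    Num.max 0 (\sum_(i <- I) Tchar abs (c i) r + N * Tchar abs a r + C).
Proof.
pose d := (\max_(i <- I) \max_(j < n.+1) tnth i j)%N.+1.
have degI i : i \in I -> forall j, (tnth i j <= d)%N.
  move=> iI j; rewrite /d ltnW// ltnS.
  apply: (@leq_trans (\max_(k < n.+1) tnth i k)); first exact: (leq_bigmax j).
  exact: (@leq_bigmax_seq _ I xpredT (fun i : n.+1.-tuple nat => (\max_(k < n.+1) tnth i k)%N)).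
have entf : entire_fun (ev (Defs.num f)) by have [] := mf; exists (Defs.num f).
have edf : entire_fun (ev (den f)) by have [_ []] := mf; exists (den f).
have ena : entire_fun (ev (Defs.num a)) by have [] := ma; exists (Defs.num a).
have eda : entire_fun (ev (den a)) by have [_ []] := ma; exists (den a).
pose cn0 i := ev (Defs.num (c i)); pose cd0 i := ev (den (c i)).
pose P0 := Omega_clear al be I d cn0 cd0 (ev (Defs.num a)) (ev (den a)).
pose N := (d * n.+1)%N.
(* At least 1 for Jensen's inequality, and at least every [abs (be j)] for the invariance of norms
   under the maps [L]. *)
pose r0 : R := 1 + \sum_(j < n.+1) abs (be j).
have r01 : 1 <= r0 by rewrite lerDl sumr_ge0// => j _; exact: (abs_ge0 absP).
have r0_gt0 : 0 < r0 := lt_le_trans ltr01 r01.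
have be_r0 j : abs (be j) <= r0.
  rewrite /r0 (bigD1 j)//= addrCA lerDl addr_ge0// sumr_ge0// => k _.
  exact: (abs_ge0 absP).
have [z1 [[dom1 dom2] Oz1]] := Omega_a.
have P0z1 : P0 z1 != 0.
  rewrite /P0 (Omega_clear_eval uI degI)// mulf_neq0//.
  rewrite mulf_neq0// prodf_seq_neq0; apply/allP => x.
    exact: dom1.
  by move=> _; apply/implyP => _; rewrite expf_neq0//; exact: dom2.
exists N%:R, (\sum_(i <- I) ln (nrm (cd0 i) r0) + N%:R * ln (nrm (ev (den a)) r0)
  - ln (nrm P0 r0)), r0 => r r0r.
have r_gt0 : 0 < r := lt_le_trans r0_gt0 r0r.
have be_r j : abs (be j) <= r := le_trans (be_r0 j) r0r.
(* Coefficients are meromorphic only for indices in [I]; elsewhere zero functions make the choice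
   total. *)
have red i : exists x : (K -> K) * (K -> K) * (K -> K),
    [/\ entire_fun x.1.1, entire_fun x.1.2, entire_fun x.2 & i \in I ->
      [/\ cn0 i = (fun z => x.1.1 z * x.1.2 z), cd0 i = (fun z => x.1.1 z * x.2 z) &
        ln (Num.max (nrm x.1.2 r) (nrm x.2 r)) <= Tchar abs (c i) r + ln (nrm x.2 r0)]].
  have [iI|_] := boolP (i \in I); last first.
    by exists (fun=> 0, fun=> 0, fun=> 0); split=> //; exact: (entire_fun_cst absP).
  have [t [g [h [[et eg eh Eg Eh] hT]]]] := mero_reduce absP absC char0 (mc iI) (le_trans r01 r0r).
  by exists (t, g, h); split=> // _; split=> //=; exact: hT.
have [q hq] := choice red.
pose tc i := (q i).1.1; pose cn i := (q i).1.2; pose cd i := (q i).2.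
have etc i : entire_fun (tc i) by have [] := hq i.
have ecn i : entire_fun (cn i) by have [] := hq i.
have ecd i : entire_fun (cd i) by have [] := hq i.
have [t [u [v [[et eu ev' Eu Ev] Ta]]]] := mero_reduce absP absC char0 ma (le_trans r01 r0r).
have {}Ta := Ta r0 r01 r0r.
pose P := Omega_clear al be I d cn cd u v.
have eP : entire_fun P by exact: (entire_Omega_clear absP absC).
have hc i z : i \in I -> cn0 i z = tc i z * cn i z /\ cd0 i z = tc i z * cd i z.
  by move=> iI; have [_ _ _ /(_ iI)[-> -> _]] := hq i.
have P0E : P0 = (fun z => (\prod_(i <- I) tc i z * \prod_(j < n.+1) t (L j z) ^+ d) * P z).
  apply/funext => z; apply: (Omega_clear_scale uI degI) => [i|j]; first exact: hc.
  by rewrite Eu Ev.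
have pos F z s : entire_fun F -> F z != 0 -> 0 < s -> 0 < nrm F s.
  by move=> eF Fz s0; exact: (gauss_norm_gt0 absP absC char0 eF s0 Fz).
have Pz1 : P z1 != 0 by move: P0z1; rewrite P0E; apply: contraNneq => ->; rewrite mulr0.
have cdpos i s : i \in I -> 0 < s -> 0 < nrm (tc i) s /\ 0 < nrm (cd i) s.
  move=> iI s0; have [z dz] := mero_den_neq0 absP absC char0 (mc iI).
  have := dz; rewrite -/(cd0 i z) (hc i z iI).2 mulf_eq0 negb_or => /andP[h1 h2].
  by split; apply: (pos _ z).
have [za dza] := mero_den_neq0 absP absC char0 ma.
have [tza vza] : t za != 0 /\ v za != 0.
  by move: dza; rewrite Ev mulf_eq0 negb_or => /andP[].
have [zf dzf] := mero_den_neq0 absP absC char0 mf.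
have tpos s : 0 < s -> 0 < nrm t s by exact: (pos t za).
have vpos s : 0 < s -> 0 < nrm v s by exact: (pos v za).
have hpos s : 0 < s -> 0 < nrm (ev (den f)) s by exact: (pos _ zf).
have Ppos s : 0 < s -> 0 < nrm P s by exact: (pos _ z1).
have eM F G : entire_fun F -> entire_fun G -> entire_fun (fun z => F z * G z).
  exact: (entire_fun_mul absP absC).
have nM F G s : entire_fun F -> entire_fun G -> 0 < s ->
    nrm (fun z => F z * G z) s = nrm F s * nrm G s.
  exact: (gauss_normM absP absC char0).
have ePtc : entire_fun (fun z => \prod_(i <- I) tc i z).
  by apply: (entire_fun_prod absP absC).
have ePL F : entire_fun F -> entire_fun (fun z => \prod_(j < n.+1) F (L j z) ^+ d).
  move=> eF; apply: (entire_fun_prod absP absC) => j _; apply: (entire_fun_exp absP absC).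
  exact: (entire_fun_affine absP absC).
(* Off the zeros of [Y] all denominators are non-zero and the equation for [f] can be evaluated; as
   [Y] is not identically zero, the cleared equation then holds everywhere. *)
pose Y z := \prod_(i <- I) (tc i z * cd i z) * \prod_(j < n.+1) ev (den f) (L j z) ^+ d.
have eY1 : entire_fun (fun z => \prod_(i <- I) (tc i z * cd i z)).
  by apply: (entire_fun_prod absP absC) => i _; exact: eM.
have eY : entire_fun Y by apply: (eM) => //; exact: ePL.
have [zY Yz] : exists z, Y z != 0.
  apply: contrapT => /forallNP hz; have Y0 : Y = fun=> 0.
    by apply/funext => z; apply: contrapT => H; exact: (hz z (introN eqP H)).
  have : 0 < nrm Y r0.
    rewrite nM ?(gauss_norm_affine_prod absP absC char0)//; last exact: ePL.
    rewrite mulr_gt0 ?exprn_gt0 ?hpos//.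
    rewrite (gauss_norm_prod absP absC char0)//; last by move=> i _; exact: eM.
    rewrite big_seq; apply: prodr_gt0 => i iI; have [h1 h2] := cdpos i r0 iI r0_gt0.
    by rewrite nM// mulr_gt0.
  by rewrite Y0 (gauss_norm_cst absP absC char0)// (abs0 absP) ltxx.
have Pf z : Omega_clear al be I d cn cd (ev (Defs.num f)) (ev (den f)) z = 0.
  move: z; apply: (entire_fun_eq0 absP absC char0 _ eY); last by exists zY.
    exact: (entire_Omega_clear absP absC).
  move=> z; have [->|] := eqVneq (Y z) 0; first by rewrite mulr0.
  rewrite mulf_eq0 negb_or !prodf_seq_neq0 => /andP[/allP hI /allP hJ].
  have cd0z i : i \in I -> tc i z != 0 /\ cd0 i z != 0.
    move=> iI; have /= h := hI i iI; rewrite (hc i z iI).2; split=> //.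
    by move: h; rewrite mulf_eq0 negb_or => /andP[].
  have hz j : ev (den f) (L j z) != 0.
    by have := hJ j (mem_index_enum j); rewrite /= expf_eq0.
  have O0 : Omega_clear al be I d cn0 cd0 (ev (Defs.num f)) (ev (den f)) z = 0.
    rewrite (Omega_clear_eval uI degI)//; last by move=> i /cd0z[].
    rewrite -[X in _ * X]/(Omega_at abs I c al be f z) Omega_f ?mulr0//.
    by split=> // i /cd0z[].
  move: O0; rewrite (Omega_clear_scale (tc := tc) (t := fun=> 1) (cn := cn) (cd := cd)
    (u := ev (Defs.num f)) (v := ev (den f)) uI degI); last 2 first.
  - by move=> i iI; exact: hc.
  - by move=> j; rewrite !mul1r.
  under [X in _ * X * _]eq_bigr do rewrite expr1n.
  rewrite big1_eq mulr1 => /eqP; rewrite mulf_eq0 => /orP[|/eqP ->]; last by rewrite mul0r.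
  by rewrite prodf_seq_eq0 => /hasP[i iI /=]; rewrite (negPf (cd0z i iI).1).
rewrite (mprox_inv_sub absP absC char0)//=.
set D := (fun z => ev (Defs.num f) z * v z - u z * ev (den f) z).
have eD : entire_fun D by apply: (entire_fun_sub absP absC); exact: eM.
have -> : (fun z => ev (Defs.num f) z * ev (den a) z - ev (Defs.num a) z * ev (den f) z) =
    (fun z => t z * D z) by apply/funext => z; rewrite Eu Ev /D; ring.
rewrite Ev !nM//.
have -> : nrm (ev (den f)) r * (nrm t r * nrm v r) / (nrm t r * nrm D r) =
    nrm (ev (den f)) r * nrm v r / nrm D r.
  by rewrite mulrCA -mulf_div divff ?mul1r// gt_eqF// tpos.
rewrite ge_max le_max lexx /= le_max; apply/orP.
(* If the norm of [D] is 0, the conventions for inverse and logarithm at 0 make the left side 0. *)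
have [D0|D0] := eqVneq (nrm D r) 0; first by left; rewrite D0 invr0 mulr0 ln0.
have Dpos : 0 < nrm D r by rewrite lt_def D0 (gauss_norm_ge0 absP absC char0).
(* When the Gauss norm of [f - a] exceeds 1, the positive part of the logarithm is already 0;
   otherwise [g v] is small enough for the product estimates. *)
have [small|big] := leP (nrm D r) (nrm (ev (den f)) r * nrm v r); last first.
  by left; rewrite ln_le0// ler_pdivrMr// mul1r ltW.
right; have key := gauss_norm_Omega_clear absP absC char0 uI degI al1 ecn ecd eu ev' entf edf
  r_gt0 be_r (vpos r r_gt0) (hpos r r_gt0) Pf small.
rewrite -/P -/D -/N in key; set Cm := \prod_(k <- I) _ in key.
set B := Num.max (nrm u r) _ in key Ta.
have Bpos : 0 < B by rewrite lt_max vpos ?orbT.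
have mpos i : i \in I -> 0 < Num.max (nrm (cn i) r) (nrm (cd i) r).
  by move=> iI; rewrite lt_max (cdpos i r iI r_gt0).2 orbT.
have Cpos : 0 < Cm by rewrite /Cm big_seq; apply: prodr_gt0.
have ratio : nrm (ev (den f)) r * nrm v r / nrm D r <= Cm * B ^+ N / nrm P r.
  rewrite ler_pdivrMr// mulrAC ler_pdivlMr ?Ppos// mulrC.
  by apply: (le_trans key).
have : ln (nrm (ev (den f)) r * nrm v r / nrm D r) <=
    \sum_(i <- I) ln (Num.max (nrm (cn i) r) (nrm (cd i) r)) + N%:R * ln B - ln (nrm P r).
  rewrite -ln_prod_seq// -/Cm mulr_natl -lnXn// -lnM ?posrE ?exprn_gt0//.
  rewrite -ln_div ?posrE ?mulr_gt0 ?exprn_gt0 ?Ppos//.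
  by rewrite ler_ln ?posrE ?divr_gt0 ?mulr_gt0 ?exprn_gt0 ?Ppos ?hpos ?vpos.
move=> /le_trans; apply.
have sumT : \sum_(i <- I) ln (Num.max (nrm (cn i) r) (nrm (cd i) r)) <=
    \sum_(i <- I) Tchar abs (c i) r + \sum_(i <- I) ln (nrm (cd i) r0).
  rewrite -big_split big_seq [leRHS]big_seq; apply: ler_sum => i iI.
  by have [_ _ _ /(_ iI)[]] := hq i.
have sumc : \sum_(i <- I) ln (nrm (cd0 i) r0) =
    \sum_(i <- I) ln (nrm (tc i) r0) + \sum_(i <- I) ln (nrm (cd i) r0).
  rewrite -big_split; apply: eq_big_seq => i iI /=.
  have [h1 h2] := cdpos i r0 iI r0_gt0.
  rewrite -lnM ?posrE// -nM//; congr (ln (nrm _ _)).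
  by apply/funext => z; rewrite (hc i z iI).2.
(* The norms of [tc] and [t] occur here with the powers they have in the other terms of [C], so they
   cancel and the reduced functions alone remain. *)
have P0n : ln (nrm P0 r0) = \sum_(i <- I) ln (nrm (tc i) r0) + N%:R * ln (nrm t r0)
    + ln (nrm P r0).
  have e1 := eM _ _ ePtc (ePL t et).
  have tcpos i : i \in I -> 0 < nrm (tc i) r0 by move=> iI; exact: (cdpos i r0 iI r0_gt0).1.
  have Tpos : 0 < \prod_(i <- I) nrm (tc i) r0 by rewrite big_seq; apply: prodr_gt0.
  rewrite P0E !nM//; last exact: ePL.
  rewrite (gauss_norm_affine_prod absP absC char0)// (gauss_norm_prod absP absC char0)//.
  by rewrite !lnM ?posrE ?mulr_gt0 ?exprn_gt0 ?tpos ?Ppos// ln_prod_seq// lnXn ?tpos// mulr_natl.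
have Pmono : ln (nrm P r0) <= ln (nrm P r).
  by rewrite ler_ln ?posrE ?Ppos// (gauss_norm_le absP absC char0).
rewrite sumc P0n lnM ?posrE ?tpos ?vpos//.
have NT : N%:R * ln B <= N%:R * (Tchar abs a r + ln (nrm v r0)) by rewrite ler_wpM2l.
rewrite !mulrDr in NT *; lra.
Qed.

End ProximityBound.

Theorem theorem1p6 (R : realType) (K : closedFieldType) (abs : K -> R)
    (n : nat) (al be : 'I_n.+1 -> K)
    (I : seq ((n.+1).-tuple nat)) (c : (n.+1).-tuple nat -> mero K)
    (f a : mero K) :
  (* kappa: algebraically closed, characteristic zero, complete for a
     non-trivial non-Archimedean absolute value *)
  [pchar K] =i pred0 ->
  is_na_abs abs -> abs_nontrivial abs -> abs_complete abs ->
  (0 < n)%N ->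
  (forall j, abs (al j) = 1) -> al ord0 = 1 -> be ord0 = 0 ->
  (forall j k : 'I_n.+1, j != k -> (al j, be j) != (al k, be k)) ->
  (* Omega is a non-zero polynomial with meromorphic coefficients *)
  uniq I -> (forall i, i \in I -> is_mero abs (c i)) ->
  (exists2 i, i \in I & mero_nonzero (c i)) ->
  (* f non-constant meromorphic with Omega(f, f o L_1, ..., f o L_n) = 0 *)
  is_mero abs f -> mero_nonconst abs f ->
  (forall z, Omega_dom abs I c al be f z -> Omega_at abs I c al be f z = 0) ->
  (* admissibility *)
  little_o_inf (fun r => \sum_(i <- I) Tchar abs (c i) r) (Tchar abs f) ->
  (* the small function a *)
  is_mero abs a ->
  little_o_inf (Tchar abs a) (Tchar abs f) ->
  (exists z, Omega_dom abs I c al be a z /\ Omega_at abs I c al be a z != 0) ->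
  little_o_inf (mprox abs (mero_inv (mero_sub f a))) (Tchar abs f).
Proof.
move=> char0 absP _ absC _ al1 _ _ _ uI mc _ mf ncf Of oc ma oa Oa e e0.
have [N [C [r1 hm]]] := mprox_bound absP absC char0 al1 uI mc mf ma Of Oa.
have [C' [r2 hT]] := Tchar_ge_ln absP absC char0 mf ncf.
(* One third each for the coefficients, for [a] and for the constant [C]. *)
have e3 : 0 < e / 3 by rewrite divr_gt0.
have N1 : 0 < 1 + `|N| by rewrite ltr_wpDr.
have [r3 hc] := oc _ e3; have [r4 ha] := oa _ (divr_gt0 e3 N1).
(* Once [ln r] exceeds [x], the lower bound for T(r, f) makes [e / 3] times it at least the absolute
   value of [C]. *)
pose x := `|C| / (e / 3) + `|C'|.
exists (Num.max (expR x) (Num.max (Num.max r1 r2) (Num.max r3 r4))) => r.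
rewrite !gt_max => /andP[rx /andP[/andP[h1 h2] /andP[h3 h4]]].
have {}hm := hm r (ltW h1); have {}hT := hT r (ltW h2).
have {}hc := hc r h3; have {}ha := ha r h4.
have r0 : 0 < r := lt_trans (expR_gt0 x) rx.
have lx : x < ln r by rewrite -[x]expRK ltr_ln ?posrE// expR_gt0.
set T := Tchar abs f r in hT hc ha *.
have CT : `|C| <= e / 3 * `|T|.
  rewrite mulrC -ler_pdivrMr//; apply: le_trans (ler_norm _).
  by have := ler_norm C'; rewrite /x in lx; lra.
have Na : N * Tchar abs a r <= e / 3 * `|T|.
  apply: (le_trans (ler_norm _)); rewrite normrM.
  apply: (@le_trans _ _ ((1 + `|N|) * (e / 3 / (1 + `|N|) * `|T|))).
    by rewrite ler_pM// ler_wpDl.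
  by rewrite mulrA [X in X * _]mulrC divfK// gt_eqF.
rewrite ger0_norm; last by rewrite /mprox le_max lexx.
apply: (le_trans hm); rewrite ge_max mulr_ge0 ?(ltW e0)//=.
have := ler_norm C; have := le_trans (ler_norm _) hc; move: CT Na; lra.
Qed.
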